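(* Let $P(z)$ be an $m\times n$, possibly singular, matrix polynomial with coefficients in $\mathbb{F}^{m\times n}$ and of grade $k\ge 2$, with right nullity $p$ and left nullity $q$, and let $v(z)$ be a nonzero scalar polynomial of grade $k-1$ with coefficients in $\mathbb{F}$. Suppose that the set of eigenvalues of $P(z)$ and the set of roots of $v(z)$, each including possibly infinite eigenvalues or roots, are disjoint. Let $L(z)=\mathbb{DL}(P,v)$ be the pencil in $\mathbb{DL}(P)$ with ansatz polynomial $v(z)$. Then: 1. The right minimal indices of $P(z)$ are $\gamma_1\le\dots\le\gamma_p$ if and only if the right minimal indices of $L(z)$ are $\underbrace{0=\dots=0}_{p(k-1)\text{ times}}\le\gamma_1\le\dots\le\gamma_p$. 2. The left minimal indices of $P(z)$ are $\eta_1\le\dots\le\eta_q$ if and only if the left minimal indices of $L(z)$ are $\underbrace{0=\dots=0}_{q(k-1)\text{ times}}\le\eta_1\le\dots\le\eta_q$. 3. $\lambda\in\mathbb{F}\cup\{\infty\}$ is an eigenvalue of $P(z)$ if and only if $\lambda$ is an eigenvalue of $L(z)$, and its partial multiplicities as an eigenvalue of $P(z)$ and as an eigenvalue of $L(z)$ coincide.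
   Context: $\mathbb{F}$ is an algebraically closed field of characteristic $0$. A (matrix or scalar) polynomial of grade $g$ is a polynomial $\sum_{i=0}^{g}z^iP_i$ where $P_g$ is allowed to be zero (i.e. degree at most $g$). A pencil is a matrix polynomial of grade $1$. Pencil $\mathbb{DL}(P,v)$: for $P(z)\in\mathbb{F}[z]^{m\times n}$ of grade $k$ and a nonzero scalar polynomial $v(z)$ of grade $k-1$ (the ansatz polynomial), put $V(x)=[x^{k-1},\dots,x,1]^T$. $\mathbb{DL}(P,v)\in\mathbb{F}[z]^{km\times kn}$ is the unique pencil $L(z)=zL_1+L_0$ such that $$(V(y)^T\otimes I_m)\,L(z)\,(V(x)\otimes I_n)=\frac{P(y)(x-z)v(x)-P(x)(y-z)v(y)}{x-y}.$$ Rank of a matrix polynomial means rank over the field $\mathbb{F}(z)$. $\lambda\in\mathbb{F}$ is a (finite) eigenvalue of $P(z)$ if $\operatorname{rank}P(\lambda)<\operatorname{rank}P(z)$. The partial multiplicities of $\lambda$ are the positive exponents $\ell_i$ of $(z-\lambda)^{\ell_i}$ in the nonzero invariant factors (diagonal entries of the Smith canonical form) of $P(z)$. For $P(z)$ of grade $k$, $\infty$ is an eigenvalue with given partial multiplicities if $0$ is an eigenvalue of $\operatorname{Rev}_kP(z)=z^kP(z^{-1})$ with those partial multiplicities; $L(z)$ is regarded as having grade $1$. A nonzero scalar polynomial $v(z)$ of grade $k-1$ has a root at $\infty$ iff $\deg v<k-1$. Right kernel: $\ker P(z)=\{x(z)\in\mathbb{F}(z)^{n}:P(z)x(z)=0\}$;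 left kernel is the right kernel of $P(z)^T$; right/left nullities are their dimensions over $\mathbb{F}(z)$. A right minimal basis of $P(z)$ is a basis of $\ker P(z)$ consisting of polynomial vectors with minimal sum of degrees among all polynomial bases; the ordered degrees of its vectors are the right minimal indices. Left minimal indices are the right minimal indices of $P(z)^T$. *)

(* Defs.v *)
From mathcomp Require Import all_boot all_order all_algebra.
From mathcomp Require Import mxtens.
From mathcomp.multinomials Require Import mpoly.
From mathcomp Require Import ring zify.

Set Implicit Arguments.
Unset Strict Implicit.
Unset Printing Implicit Defensive.

Import GRing.Theory.
Local Open Scope ring_scope.

Section MatrixPolynomials.
Variable F : fieldType.

Definition has_grade (g m n : nat) (P : 'M[{poly F}]_(m, n)) : Prop :=
  forall i j, (size (P i j) <= g.+1)%N.

Definition ratmx (m n : nat) (P : 'M[{poly F}]_(m, n)) :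
    'M[{fraction {poly F}}]_(m, n) :=
  map_mx (@tofrac _) P.

(* [P(a)], for [a] in any F-algebra. *)
Definition evalmx (A : algType F) (a : A) (m n : nat)
    (P : 'M[{poly F}]_(m, n)) : 'M[A]_(m, n) :=
  map_mx (horner_alg a) P.

(* [z^g P(1/z)], for [P] of grade [g]. *)
Definition revmx (g m n : nat) (P : 'M[{poly F}]_(m, n)) :
    'M[{poly F}]_(m, n) :=
  map_mx (fun p : {poly F} => \poly_(i < g.+1) p`_(g - i)) P.

(* Points of F extended with infinity are encoded in [option F]; [None] is
   infinity. *)
Definition fin_eigenvalue (m n : nat) (P : 'M[{poly F}]_(m, n)) (a : F) : Prop :=
  (\rank (map_mx (horner^~ a) P) < \rank (ratmx P))%N.

Definition eigenvalue_at (g m n : nat) (P : 'M[{poly F}]_(m, n))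
    (lambda : option F) : Prop :=
  match lambda with
  | Some a => fin_eigenvalue P a
  | None => fin_eigenvalue (revmx g P) 0
  end.

Definition root_at (g : nat) (v : {poly F}) (lambda : option F) : Prop :=
  match lambda with
  | Some a => root v a
  | None => ((size v).-1 < g)%N
  end.

(* [s] lists the nonzero invariant factors of [P]; the remaining diagonal
   entries of the Smith form are 0, the default value of [s`_i]. *)
Definition invariant_factors (m n : nat) (P : 'M[{poly F}]_(m, n))
    (s : seq {poly F}) : Prop :=
  [/\ (size s <= minn m n)%N,
      all (fun d : {poly F} => d \is monic) s,
      sorted (fun d e : {poly F} => d %| e) s &
      exists U : 'M[{poly F}]_m, exists V : 'M[{poly F}]_n,
        [/\ U \in unitmx, V \in unitmx &
            U *m P *m V = \matrix_(i, j) (s`_i *+ (i == j :> nat))]].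

Definition fin_partial_mults (m n : nat) (P : 'M[{poly F}]_(m, n)) (a : F)
    (l : seq nat) : Prop :=
  exists2 s, invariant_factors P s &
             l = [seq e <- [seq mup a d | d <- s] | (0 < e)%N].

Definition partial_mults (g m n : nat) (P : 'M[{poly F}]_(m, n))
    (lambda : option F) (l : seq nat) : Prop :=
  match lambda with
  | Some a => fin_partial_mults P a l
  | None => fin_partial_mults (revmx g P) 0 l
  end.

(* The rows of [rker P] span the transposes of the vectors [x] such that
   [P *m x = 0] over the field of rational functions. *)
Definition rker (m n : nat) (P : 'M[{poly F}]_(m, n)) :
    'M[{fraction {poly F}}]_n :=
  kermx (ratmx P)^T.

Definition right_nullity (m n : nat) (P : 'M[{poly F}]_(m, n)) : nat :=
  \rank (rker P).

Definition left_nullity (m n : nat) (P : 'M[{poly F}]_(m, n)) : nat :=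
  right_nullity P^T.

(* The columns of [B] form a basis of the right kernel of [P]. *)
Definition poly_basis (m n r : nat) (P : 'M[{poly F}]_(m, n))
    (B : 'M[{poly F}]_(n, r)) : Prop :=
  row_free (ratmx B)^T /\ ((ratmx B)^T == rker P)%MS.

Definition col_degree (n r : nat) (B : 'M[{poly F}]_(n, r)) (j : 'I_r) : nat :=
  \max_i (size (B i j)).-1.

Definition minimal_basis (m n r : nat) (P : 'M[{poly F}]_(m, n))
    (B : 'M[{poly F}]_(n, r)) : Prop :=
  poly_basis P B /\
  forall B' : 'M[{poly F}]_(n, r), poly_basis P B' ->
    (\sum_j col_degree B j <= \sum_j col_degree B' j)%N.

Definition right_minimal_indices (m n : nat) (P : 'M[{poly F}]_(m, n))
    (gamma : seq nat) : Prop :=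
  exists2 B : 'M[{poly F}]_(n, right_nullity P), minimal_basis P B &
    gamma = sort leq [seq col_degree B j | j <- enum 'I_(right_nullity P)].

Definition left_minimal_indices (m n : nat) (P : 'M[{poly F}]_(m, n))
    (eta : seq nat) : Prop :=
  right_minimal_indices P^T eta.

Definition powcol (A : nzRingType) (k : nat) (x : A) : 'cV[A]_k :=
  \col_i x ^+ (k.-1 - i).

(* The identity defining DL(P, v), with the denominator [x - y] cleared. *)
Definition DL_identity (A : comAlgType F) (x y z : A) (k m n : nat)
    (P : 'M[{poly F}]_(m, n)) (v : {poly F})
    (L : 'M[{poly F}]_(k * m, k * n)) : Prop :=
  (x - y) *: castmx (mul1n m, mul1n n)
    (((powcol k y)^T *t 1%:M) *m evalmx z L *m (powcol k x *t 1%:M)) =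
  ((x - z) * horner_alg x v) *: evalmx y P -
  ((y - z) * horner_alg y v) *: evalmx x P.

(* [L] is the pencil DL(P, v): the identity holds for three independent
   indeterminates.  See [DL_exists] and [DL_unique] below. *)
Definition is_DL (k m n : nat) (P : 'M[{poly F}]_(m, n)) (v : {poly F})
    (L : 'M[{poly F}]_(k * m, k * n)) : Prop :=
  has_grade 1 L /\
  DL_identity ('X_(inord 0) : {mpoly F[3]}) 'X_(inord 1) 'X_(inord 2) P v L.

End MatrixPolynomials.

Section DLWellDefined.
Variable F : fieldType.

Lemma DL_lhsE (A : algType F) (x y z : A) (k m n : nat)
    (L : 'M[{poly F}]_(k * m, k * n)) (a : 'I_m) (b : 'I_n) :
  castmx (mul1n m, mul1n n)
    (((powcol k y)^T *t 1%:M) *m evalmx z L *m (powcol k x *t 1%:M)) a b =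
  \sum_(i < k) \sum_(j < k) y ^+ (k.-1 - i) *
     horner_alg z (L (mxtens_index (i, a)) (mxtens_index (j, b))) *
     x ^+ (k.-1 - j).
Proof.
have -> (M : 'M[A]_(1 * m, 1 * n)) :
    castmx (mul1n m, mul1n n) M a b =
    M (mxtens_index (ord0, a)) (mxtens_index (ord0, b)).
  by rewrite castmxE; congr (M _ _); apply: val_inj; rewrite /= mul0n.
rewrite mxE exchange_big /=.
have reidx (q : nat) (f : 'I_(k * q) -> A) :
    \sum_t f t = \sum_(j < k) \sum_(c < q) f (mxtens_index (j, c)).
  rewrite pair_big /= (reindex (@mxtens_index k q)).
    by apply: eq_bigr => -[j c] _.
  by exists (@mxtens_unindex k q) => u _; rewrite (mxtens_indexK, mxtens_unindexK).
rewrite reidx; apply: eq_bigr => j _.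
rewrite (bigD1 b) //= big1 ?addr0 => [|c nc]; last first.
  by rewrite [X in _ * X]tensmxE !mxE (negPf nc) !mulr0.
rewrite [X in _ * X]tensmxE !mxE eqxx mulr1 mulr_suml.
rewrite reidx; apply: eq_bigr => i _.
rewrite (bigD1 a) //= big1 ?addr0 => [|c nc]; last first.
  by rewrite tensmxE !mxE eq_sym (negPf nc) mulr0 !mul0r.
by rewrite tensmxE !mxE eqxx mulr1.
Qed.

Section Span.
Variables (A : comAlgType F) (x y z : A) (k : nat).

Let spanned (f : A) : Prop :=
  exists2 C : 'I_k -> 'I_k -> {poly F}, forall i j, (size (C i j) <= 2)%N &
    f = \sum_(i < k) \sum_(j < k) y ^+ (k.-1 - i) * horner_alg z (C i j) *
          x ^+ (k.-1 - j).

Let spannedD f g : spanned f -> spanned g -> spanned (f + g).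
Proof.
case=> C sC -> [D sD ->]; exists (fun i j => C i j + D i j) => [i j|].
  by rewrite (leq_trans (size_polyD _ _)) // geq_max sC sD.
rewrite -big_split; apply: eq_bigr => i _; rewrite -big_split.
by apply: eq_bigr => j _; rewrite rmorphD mulrDr mulrDl.
Qed.

Let spannedZ (c : F) f : spanned f -> spanned (c *: f).
Proof.
case=> C sC ->; exists (fun i j => c *: C i j) => [i j|].
  by rewrite (leq_trans (size_scale_leq _ _)).
rewrite scaler_sumr; apply: eq_bigr => i _; rewrite scaler_sumr.
by apply: eq_bigr => j _; rewrite linearZ /= mulr_algl -scalerAr -scalerAl.
Qed.

Let spanned0 : spanned 0.
Proof.
exists (fun _ _ => 0) => [i j|]; first by rewrite size_poly0.
by rewrite big1 // => i _; rewrite big1 // => j _; rewrite rmorph0 mulr0 mul0r.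
Qed.

Let spanned_sum I (r : seq I) (P : pred I) (f : I -> A) :
  (forall i, P i -> spanned (f i)) -> spanned (\sum_(i <- r | P i) f i).
Proof. by move=> H; apply: big_ind => //. Qed.

Let spanned_monom (s t : nat) (c : {poly F}) : (size c <= 2)%N ->
  (s < k)%N -> (t < k)%N -> spanned (horner_alg z c * (x ^+ s * y ^+ t)).
Proof.
move=> sc sk tk; pose i0 : 'I_k := rev_ord (Ordinal tk).
pose j0 : 'I_k := rev_ord (Ordinal sk).
have e (u : nat) : (u < k)%N -> (k.-1 - (k - u.+1))%N = u.
  case: (k) => [//|k'] uk /=.
  by rewrite subSS subKn.
exists (fun i j => c *+ ((i == i0) && (j == j0))) => [i j|].
  by case: (_ && _) => //; rewrite size_poly0.
rewrite (bigD1 i0) //= [X in _ + X]big1 ?addr0 => [|i ni]; last first.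
  by rewrite big1 // => j _; rewrite (negPf ni) rmorph0 mulr0 mul0r.
rewrite (bigD1 j0) //= [X in _ + X]big1 ?addr0 => [|j nj]; last first.
  by rewrite (negPf nj) andbF rmorph0 mulr0 mul0r.
by rewrite !eqxx /= !e //; ring.
Qed.

Let divisible (f : A) : Prop := exists2 g, spanned g & f = (x - y) * g.

Let divD f g : divisible f -> divisible g -> divisible (f + g).
Proof. by case=> f' sf -> [g' sg ->]; exists (f' + g'); [exact: spannedD|rewrite mulrDr]. Qed.

Let divZ (c : F) f : divisible f -> divisible (c *: f).
Proof. by case=> f' sf ->; exists (c *: f'); [exact: spannedZ|rewrite scalerAr]. Qed.

Let div_sum I (r : seq I) (P : pred I) (f : I -> A) :
  (forall i, P i -> divisible (f i)) -> divisible (\sum_(i <- r | P i) f i).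
Proof.
by move=> H; apply: big_ind => //; exists 0; rewrite ?mulr0.
Qed.

Let div_anti (c : {poly F}) (a b : nat) : (size c <= 2)%N -> (a <= k)%N ->
  (b <= k)%N -> divisible (horner_alg z c * (x ^+ b * y ^+ a - y ^+ b * x ^+ a)).
Proof.
wlog ab : a b / (a <= b)%N => [H sc ak bk|sc ak bk].
  case/orP: (leq_total a b) => ab; first exact: H.
  have -> : x ^+ b * y ^+ a - y ^+ b * x ^+ a =
            - (x ^+ a * y ^+ b - y ^+ a * x ^+ b).
    by rewrite opprB mulrC [X in _ - X]mulrC.
  by rewrite mulrN -scaleN1r; apply: divZ; apply: H.
exists (\sum_(i < b - a) horner_alg z c *
          (x ^+ (a + (b - a - i.+1)) * y ^+ (a + i))).
  apply: spanned_sum => i _; apply: spanned_monom => //.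
    by have := ltn_ord i; lia.
  by have := ltn_ord i; lia.
have -> : x ^+ b * y ^+ a - y ^+ b * x ^+ a =
    (x ^+ a * y ^+ a) * (x ^+ (b - a) - y ^+ (b - a)).
  by rewrite -[in LHS](subnKC ab) !exprD; ring.
rewrite subrXX mulrCA [horner_alg z c * _]mulrCA mulrCA; congr (_ * _).
rewrite !mulr_sumr; apply: eq_bigr => i _.
have -> : (b - a - i.+1 = (b - a).-1 - i)%N by lia.
by rewrite !exprD; ring.
Qed.

Lemma DL_entry_exists (p v : {poly F}) : (size p <= k.+1)%N -> (size v <= k)%N ->
  exists2 C : 'I_k -> 'I_k -> {poly F}, forall i j, (size (C i j) <= 2)%N &
    (x - y) * (\sum_(i < k) \sum_(j < k) y ^+ (k.-1 - i) *
                 horner_alg z (C i j) * x ^+ (k.-1 - j)) =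
    (x - z) * horner_alg x v * horner_alg y p -
    (y - z) * horner_alg y v * horner_alg x p.
Proof.
move=> sp sv.
have ev (q : {poly F}) (d : nat) (u : A) : (size q <= d)%N ->
    horner_alg u q = \sum_(i < d) q`_i *: u ^+ i.
  move=> sq; rewrite /horner_alg /horner_morph (horner_coef_wide _ (n := d)).
    by apply: eq_bigr => i _; rewrite coef_map /= -scalerAl mul1r.
  by rewrite (leq_trans (size_poly _ _)).
suff [_ [C sC ->] H] : divisible ((x - z) * horner_alg x v * horner_alg y p -
    (y - z) * horner_alg y v * horner_alg x p) by exists C.
rewrite !(ev _ _ _ sp) !(ev _ _ _ sv).
have -> : (x - z) * (\sum_(i < k) v`_i *: x ^+ i) *
            (\sum_(i < k.+1) p`_i *: y ^+ i) -
          (y - z) * (\sum_(i < k) v`_i *: y ^+ i) *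
            (\sum_(i < k.+1) p`_i *: x ^+ i) =
  \sum_(a < k.+1) \sum_(b < k) (p`_a * v`_b) *:
     (horner_alg z 1 * (x ^+ b.+1 * y ^+ a - y ^+ b.+1 * x ^+ a) -
      horner_alg z 'X * (x ^+ b * y ^+ a - y ^+ b * x ^+ a)).
  rewrite !mulr_sumr -sumrB; apply: eq_bigr => a _.
  rewrite !mulr_suml -sumrB; apply: eq_bigr => b _.
  rewrite rmorph1 horner_algX mul1r -!scalerAr -!scalerAl !scalerA.
  rewrite -scalerBr; congr (_ *: _); rewrite !exprS; ring.
apply: div_sum => a _; apply: div_sum => b _; apply: divZ.
apply: divD; first by apply: div_anti; rewrite ?size_poly1 // -ltnS.
rewrite -scaleN1r; apply: divZ; apply: div_anti; rewrite ?size_polyX //.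
  by rewrite -ltnS.
exact: ltnW.
Qed.

End Span.

Lemma DL_identityE (A : comAlgType F) (x y z : A) (k m n : nat)
    (P : 'M[{poly F}]_(m, n)) (v : {poly F})
    (L : 'M[{poly F}]_(k * m, k * n)) :
  DL_identity x y z P v L <-> forall a b,
  (x - y) * (\sum_(i < k) \sum_(j < k) y ^+ (k.-1 - i) *
     horner_alg z (L (mxtens_index (i, a)) (mxtens_index (j, b))) *
     x ^+ (k.-1 - j)) =
  (x - z) * horner_alg x v * horner_alg y (P a b) -
  (y - z) * horner_alg y v * horner_alg x (P a b).
Proof.
rewrite /DL_identity; split=> [/matrixP H a b|H].
  have := H a b; rewrite mxE DL_lhsE => ->.
  by rewrite !mxE.
by apply/matrixP => a b; rewrite mxE DL_lhsE H !mxE.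
Qed.

Lemma DL_exists (k m n : nat) (P : 'M[{poly F}]_(m, n)) (v : {poly F}) :
  has_grade k P -> (size v <= k)%N ->
  exists L : 'M[{poly F}]_(k * m, k * n), is_DL P v L.
Proof.
move=> gP sv; rewrite /is_DL.
move: 'X_(inord 0) 'X_(inord 1) 'X_(inord 2).
move: ({mpoly F[3]} : comAlgType F) => A x y z.
have /fin_all_exists [C HC] (ab : 'I_m * 'I_n) :=
  let: ex_intro2 C H1 H2 := DL_entry_exists x y z (gP ab.1 ab.2) sv in
  ex_intro (fun C => _ /\ _) C (conj H1 H2).
pose G (s : 'I_(k * m)) (t : 'I_(k * n)) :=
  C ((mxtens_unindex s).2, (mxtens_unindex t).2)
    (mxtens_unindex s).1 (mxtens_unindex t).1.
have GE i a j b : G (mxtens_index (i, a)) (mxtens_index (j, b)) = C (a, b) i j.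
  by rewrite /G !mxtens_indexK.
exists (\matrix_(s, t) G s t).
split=> [s t|]; first by rewrite mxE /G; apply: (proj1 (HC _)).
apply/DL_identityE => a b; rewrite -(proj2 (HC (a, b))); congr (_ * _).
by apply: eq_bigr => i _; apply: eq_bigr => j _; rewrite mxE GE.
Qed.

Lemma DL_identity_inj (A : comAlgType F) (x y z : A)
    (phi : {rmorphism A -> {poly {poly {poly F}}}}) (k m n : nat)
    (P : 'M[{poly F}]_(m, n)) (v : {poly F})
    (L L' : 'M[{poly F}]_(k * m, k * n)) :
  phi x = 'X -> phi y = 'X%:P -> phi z = 'X%:P%:P ->
  (forall c : F, phi c%:A = c%:P%:P%:P) ->
  DL_identity x y z P v L -> DL_identity x y z P v L' -> L = L'.
Proof.
move=> phix phiy phiz phic /DL_identityE E /DL_identityE E'.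
apply/matrixP => s t.
case: (mxtens_indexP s) => i0 a; case: (mxtens_indexP t) => j0 b.
have phiD q : phi (horner_alg z q) = q%:P%:P.
  elim/poly_ind: q => [|q c IH]; first by rewrite !rmorph0.
  by rewrite !rmorphD !rmorphM /= horner_algX horner_algC IH phiz phic.
pose Q (M : 'M[{poly F}]_(k * m, k * n)) : {poly {poly {poly F}}} :=
  \sum_(j < k) (\sum_(i < k)
     (M (mxtens_index (i, a)) (mxtens_index (j, b)))%:P *
       'X^(k.-1 - i))%:P * 'X^(k.-1 - j).
have QE (M : 'M[{poly F}]_(k * m, k * n)) : phi (\sum_(i < k) \sum_(j < k) y ^+ (k.-1 - i) *
     horner_alg z (M (mxtens_index (i, a)) (mxtens_index (j, b))) *
     x ^+ (k.-1 - j)) = Q M.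
  rewrite exchange_big rmorph_sum; apply: eq_bigr => j _ /=.
  rewrite rmorph_sum [X in X * _]rmorph_sum mulr_suml; apply: eq_bigr => i _ /=.
  rewrite !rmorphM !rmorphXn /= phiD phix phiy.
  by congr (_ * _); rewrite mulrC.
have /(congr1 phi) := etrans (E a b) (esym (E' a b)).
rewrite !rmorphM !QE rmorphB phix phiy.
move/(mulfI (monic_neq0 (monicXsubC _))).
have sub_inj (i j : 'I_k) : (k.-1 - i == k.-1 - j)%N = (i == j).
  by rewrite -val_eqE /=; have := ltn_ord i; have := ltn_ord j; lia.
have pick (R : nzRingType) (f : 'I_k -> R) (j : 'I_k) :
   (\sum_(j < k) (f j)%:P * 'X^(k.-1 - j))`_(k.-1 - j) = f j.
  rewrite coef_sum (bigD1 j) //= big1 ?addr0 => [|j' nj].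
    by rewrite coefCM coefXn eqxx mulr1.
  by rewrite coefCM coefXn sub_inj eq_sym (negPf nj) mulr0.
move=> /(congr1 (fun q : {poly {poly {poly F}}} => q`_(k.-1 - j0))).
rewrite !pick => /(congr1 (fun q : {poly {poly F}} => q`_(k.-1 - i0))).
by rewrite !pick.
Qed.

Lemma DL_unique (k m n : nat) (P : 'M[{poly F}]_(m, n)) (v : {poly F})
    (L L' : 'M[{poly F}]_(k * m, k * n)) :
  is_DL P v L -> is_DL P v L' -> L = L'.
Proof.
pose h (i : 'I_3) : {poly {poly {poly F}}} :=
  if i == inord 0 then 'X else if i == inord 1 then 'X%:P else 'X%:P%:P.
pose c3 : {rmorphism F -> {poly {poly {poly F}}}} := polyC \o (polyC \o polyC).
have hX i : mmap c3 h 'X_i = h i by rewrite mmapX mmap1U.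
have hC c : mmap c3 h c%:MP = c3 c by rewrite mmapC.
move=> [_ E] [_ E'].
apply: (@DL_identity_inj _ _ _ _ (mmap c3 h) _ _ _ _ _ _ _ _ _ _ _ E E').
- by apply: etrans (hX _) _; rewrite /h eqxx.
- by apply: etrans (hX _) _; rewrite /h -!val_eqE /= !inordK.
- by apply: etrans (hX _) _; rewrite /h -!val_eqE /= !inordK.
- by move=> c; apply: etrans (hC c); congr (mmap _ _ _); apply: alg_mpolyC.
Qed.

End DLWellDefined.

(* Main.v *)
Require Import Defs.
From mathcomp Require Import all_boot all_order all_algebra.
From HB Require Import structures.
From mathcomp Require Import perm mxtens ring zify.
From Stdlib Require Import Classical_Prop.

(* Block vectors w of length k n are functionals f |-> w(f) in F(z)^n on the
   polynomials f(x) of degree less than k.  Writing Bez for the block Bezoutian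
   (P(y) v(x) - P(x) v(y)) / (x - y), the pencil acts by
   L(z) w = P(y) w(v) + (y - z) w(Bez), so w |-> w(v) maps ker L(z) to ker P(z),
   with kernel N (x) F(z), where N = {w constant : w(v) = 0, w(Bez) = 0} does not
   involve z.  At every point where v does not vanish the map is onto, through
   u |-> (f |-> f(z) u), both for honest kernels and for kernels modulo
   (z - a)^h; this transfers ranks and partial multiplicities, whereas at a root
   of v the map alone shows that L has no eigenvalue.  Infinity is reduced to 0
   by reversal.

   A kernel vector u of P of degree d lifts to a kernel vector of L of the same
   degree, f |-> (f u) div v.  Since the number of minimal indices at most d is
   the rank over F(z) of the kernel vectors of degree at most d, L has the
   minimal indices of P together with dim N zeros.

   Finally dim N = p (k - 1): the functionals of N split into a part modulo v,
   which is the kernel of P on (F[x]/v)^n, and a part at infinity, which is the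
   kernel of Rev P modulo x^(k - 1 - deg v).  As no root of v is an eigenvalue of
   P, the Smith form shows that both kernels are free of rank p. *)

Set Implicit Arguments.
Unset Strict Implicit.
Unset Printing Implicit Defensive.

Import GRing.Theory.
Local Open Scope ring_scope.

(** * Smith normal form *)

Section Smith.
Variable F : fieldType.
Implicit Types (p q : {poly F}) (s : seq {poly F}).

(** The space N enters the eigenvalue half only through its unknown dimension, which shifts the
    nullity over F(z) and every local kernel dimension by the same amount and so cancels in the
    partial multiplicities; its value matters for the minimal indices. Lists of multiplicities or
    indices are compared through choice-free numbers: dimensions of the values of kernel vectors
    modulo a power of z - a, and ranks of the kernel vectors of bounded degree. Each equivalence
    then follows because both sides possess such a list and either list determines the other. Behind
    N at the finite roots of v is the residue duality that pairs f and g in F[x]/v by the residue of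
    f g / v at infinity; it turns kernel vectors of P modulo v into functionals. Left indices come
    from transposition, since exchanging x and y in the identity of DL gives the identity for the
    transposes. *)

Definition diag_seq m n s : 'M[{poly F}]_(m, n) :=
  \matrix_(i, j) (s`_i *+ (i == j :> nat)).

Definition equiv_mx m n (A B : 'M[{poly F}]_(m, n)) : Prop :=
  exists U : 'M_m, exists V : 'M_n,
    [/\ U \in unitmx, V \in unitmx & U *m A *m V = B].

Lemma equiv_mx_refl m n (A : 'M[{poly F}]_(m, n)) : equiv_mx A A.
Proof.
by exists 1%:M, 1%:M; split; rewrite ?unitmx1 // mul1mx mulmx1.
Qed.

Lemma equiv_mx_trans m n (B A C : 'M[{poly F}]_(m, n)) :
  equiv_mx A B -> equiv_mx B C -> equiv_mx A C.
Proof.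
move=> [U [V [uU uV <-]]] [U' [V' [uU' uV' <-]]].
exists (U' *m U), (V *m V'); split; rewrite ?unitmx_mul ?uU ?uU' ?uV ?uV' //.
by rewrite !mulmxA.
Qed.

Lemma equiv_mx_sym m n (A B : 'M[{poly F}]_(m, n)) :
  equiv_mx A B -> equiv_mx B A.
Proof.
move=> [U [V [uU uV <-]]]; exists (invmx U), (invmx V).
by split; rewrite ?unitmx_inv // !mulmxA mulVmx // mul1mx mulmxK.
Qed.

Lemma equiv_mx_tr m n (A B : 'M[{poly F}]_(m, n)) :
  equiv_mx A B -> equiv_mx A^T B^T.
Proof.
move=> [U [V [uU uV <-]]]; exists V^T, U^T; rewrite !unitmx_tr.
by split=> //; rewrite !trmx_mul mulmxA.
Qed.

Lemma equiv_mx_mull m n (U : 'M_m) (A : 'M[{poly F}]_(m, n)) :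
  U \in unitmx -> equiv_mx A (U *m A).
Proof.
by move=> uU; exists U, 1%:M; rewrite unitmx1 mulmx1.
Qed.

Lemma equiv_mx_mulr m n (V : 'M_n) (A : 'M[{poly F}]_(m, n)) :
  V \in unitmx -> equiv_mx A (A *m V).
Proof.
by move=> uV; exists 1%:M, V; rewrite unitmx1 mul1mx.
Qed.

Lemma equiv_mx_xrow m n i j (A : 'M[{poly F}]_(m, n)) :
  equiv_mx A (xrow i j A).
Proof. by rewrite xrowE; apply: equiv_mx_mull; apply: unitmx_perm. Qed.

Lemma equiv_mx_xcol m n i j (A : 'M[{poly F}]_(m, n)) :
  equiv_mx A (xcol i j A).
Proof. by rewrite xcolE; apply: equiv_mx_mulr; apply: unitmx_perm. Qed.

Lemma equiv_mx_addrow m n (i j : 'I_m) q (A : 'M[{poly F}]_(m, n)) :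
  i != j ->
  equiv_mx A (\matrix_(a, b) (A a b + (q * A j b) *+ (a == i))).
Proof.
move=> ij.
have dd : delta_mx i j *m delta_mx i j = 0 :> 'M[{poly F}]_m.
  by rewrite mul_delta_mx_0 // eq_sym.
have -> : \matrix_(a, b) (A a b + (q * A j b) *+ (a == i)) =
    (1%:M + q *: delta_mx i j) *m A.
  apply/matrixP => a b; rewrite mulmxDl mul1mx !mxE; congr (_ + _).
  rewrite (bigD1 j) //= big1 => [|c cj].
    by rewrite !mxE eqxx andbT addr0 -mulrA; case: eqP; rewrite ?mulr1 ?mul1r ?mul0r ?mulr0.
  by rewrite !mxE (negPf cj) andbF mulr0 mul0r.
apply: equiv_mx_mull.
suff: (1%:M + q *: delta_mx i j) *m (1%:M - q *: delta_mx i j) = 1%:M.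
  by case/mulmx1_unit.
rewrite mulmxBr mulmx1 mulmxDl mul1mx -scalemxAl -scalemxAr dd !scaler0 addr0.
by rewrite addrK.
Qed.

(** Euclidean division: subtracting a multiple of row 0 from row [i] leaves the remainder in column
    0, and a row swap makes it the new pivot. *)
Lemma pivot_step m n (A : 'M[{poly F}]_(m.+1, n.+1)) i :
  A 0 0 != 0 -> ~~ (A 0 0 %| A i 0) ->
  exists2 B, equiv_mx A B & (B 0 0 != 0) && (size (B ord0 ord0) < size (A ord0 ord0))%N.
Proof.
move=> a0 ndiv.
have i0 : i != 0 by apply: contraNneq ndiv => ->.
pose q := - (A i 0 %/ A 0 0).
exists (xrow 0 i (\matrix_(a, b) (A a b + (q * A 0 b) *+ (a == i)))).
  by apply: equiv_mx_trans (equiv_mx_xrow _ _ _); apply: equiv_mx_addrow.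
rewrite !mxE tpermL eqxx mulr1n /q mulNr.
have -> : A i 0 - A i 0 %/ A 0 0 * A 0 0 = A i 0 %% A 0 0.
  by rewrite [X in X - _](divp_eq _ (A 0 0)) addrAC subrr add0r.
by rewrite ltn_modp a0 andbT; apply: contra ndiv => /eqP/modp_eq0P.
Qed.

(** Induction on the size of the corner entry. If the corner fails to divide its column, its row, or
    the block left after clearing both, a division step yields a smaller corner. *)
Lemma pivot_exists m n (A : 'M[{poly F}]_(m.+1, n.+1)) : A != 0 ->
  exists (a : {poly F}) (B : 'M_(m, n)),
    [/\ a \is monic, forall i j, a %| B i j &
        equiv_mx A (block_mx a%:M 0 0 B : 'M_(1 + m, 1 + n))].
Proof.
move=> A0.
have [i [j Aij]] : exists i j, A i j != 0.
  case: (boolP [exists i, exists j, A i j != 0]) => [|nex].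
    by case/existsP => i /existsP[j]; exists i, j.
  case/negP: A0; apply/eqP/matrixP => i j; rewrite mxE; apply/eqP.
  by apply: contraNT nex => Aij; apply/existsP; exists i; apply/existsP; exists j.
have {i j Aij A0} [B AB B0] : exists2 B, equiv_mx A B & B 0 0 != 0.
  exists (xrow 0 i (xcol 0 j A)); last by rewrite !mxE !tpermL.
  exact: equiv_mx_trans (equiv_mx_xcol _ _ _) (equiv_mx_xrow _ _ _).
suff [a [C [ma dC BC]]] : exists (a : {poly F}) (C : 'M_(m, n)),
    [/\ a \is monic, forall i j, a %| C i j &
        equiv_mx B (block_mx a%:M 0 0 C : 'M_(1 + m, 1 + n))].
  by exists a, C; split=> //; apply: equiv_mx_trans AB BC.
move: {2}(size (B 0 0)) (leqnn (size (B 0 0))) => d; clear A AB.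
elim: d B B0 => [B B0|d IH B B0 sB].
  by rewrite leqn0 size_poly_eq0 (negPf B0).
have step (C : 'M_(m.+1, n.+1)) : equiv_mx B C ->
    (C 0 0 != 0) && (size (C ord0 ord0) < size (B ord0 ord0))%N ->
    exists (a : {poly F}) (D : 'M_(m, n)),
    [/\ a \is monic, forall i j, a %| D i j &
        equiv_mx B (block_mx a%:M 0 0 D : 'M_(1 + m, 1 + n))].
  move=> BC /andP[C0 sC].
  have [|a [D [ma dD CD]]] := IH C C0; first by rewrite -ltnS (leq_trans sC).
  by exists a, D; split=> //; apply: equiv_mx_trans BC CD.
case: (boolP [forall i, B 0 0 %| B i 0]) => [/forallP dcol|]; last first.
  by case/forallPn => i ndiv; have [C BC sC] := pivot_step B0 ndiv; apply: step sC.
case: (boolP [forall j, B 0 0 %| B 0 j]) => [/forallP drow|]; last first.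
  case/forallPn => j ndiv; have [||C BC sC] := @pivot_step _ _ B^T j.
  - by rewrite mxE.
  - by rewrite !mxE.
  apply: (step C^T); last by move: sC; rewrite !mxE.
  by rewrite -[B]trmxK; apply: equiv_mx_tr.
pose b := B 0 0.
pose x : 'cV[{poly F}]_m := \col_i (B (lift ord0 i) 0 %/ b).
pose y : 'rV[{poly F}]_n := \row_j (B 0 (lift ord0 j) %/ b).
pose B4 : 'M_(m, n) := \matrix_(i, j) B (lift ord0 i) (lift ord0 j).
have uU : (block_mx 1%:M 0 (- x) 1%:M : 'M[{poly F}]_(1 + m)) \in unitmx.
  by rewrite unitmxE det_lblock !det1 mulr1 unitr1.
have uV : (block_mx 1%:M (- y) 0 1%:M : 'M[{poly F}]_(1 + n)) \in unitmx.
  by rewrite unitmxE det_ublock !det1 mulr1 unitr1.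
pose C := B4 - x *m (b *: y).
have lift0E t (i : 'I_t) : rshift 1 i = lift ord0 i by apply: val_inj.
have BE : B = block_mx b%:M (b *: y) (b *: x) B4 :> 'M_(1 + m, 1 + n).
  apply/matrixP => i j.
  case: (fintype.split_ordP (m := 1) i) => i' ->; case: (fintype.split_ordP (m := 1) j) => j' ->;
    rewrite ?block_mxEul ?block_mxEur ?block_mxEdl ?block_mxEdr !mxE ?ord1 //=.
  - by rewrite mulr1n; congr (B _ _); apply: val_inj.
  - rewrite mulrC divpK ?lift0E //.
    by congr (B _ _); apply: val_inj.
  - rewrite mulrC divpK ?lift0E //.
    by congr (B _ _); apply: val_inj.
  - by rewrite !lift0E.
have BC : @equiv_mx (1 + m) (1 + n) B (block_mx b%:M 0 0 C).
  rewrite [X in equiv_mx X]BE; exists (block_mx 1%:M 0 (- x) 1%:M : 'M_(1 + m)),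
     (block_mx 1%:M (- y) 0 1%:M : 'M_(1 + n)).
  split=> //; rewrite !mulmx_block !mul1mx !mul0mx !mulmx1 !mulmx0 !addr0.
  congr block_mx.
  - by rewrite mul_scalar_mx scalerN addNr.
  - by rewrite mulNmx mul_mx_scalar addNr.
  - by rewrite !mulNmx mul_mx_scalar addNr mul0mx add0r addrC.
case: (boolP [forall i, forall j, b %| C i j]) => [/forallP dC0|].
  have dC i j : b %| C i j by have /forallP := dC0 i; apply.
  pose c := (lead_coef b)^-1; have c0 : c != 0 by rewrite invr_eq0 lead_coef_eq0.
  exists (c *: b), C; split.
  - by rewrite monicE lead_coefZ mulVf // lead_coef_eq0.
  - by move=> i j; rewrite dvdpZl.
  apply: (@equiv_mx_trans (1 + m) (1 + n) _ _ _ BC).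
  exists (block_mx (c%:P)%:M 0 0 1%:M : 'M_(1 + m)), 1%:M.
  split; rewrite ?unitmx1 //.
    rewrite unitmxE det_lblock det1 mulr1 det_scalar expr1.
    by rewrite rmorph_unit // unitfE.
  rewrite mulmx1 !mulmx_block !mul1mx !mul0mx !mulmx0 !addr0 !add0r.
  by rewrite -scalar_mxM mul_polyC.
case/forallPn=> i /forallPn[j ndiv].
(* Adding row [i] of [C] to the top row puts an entry that [b] does not divide beside [b]; a column
   step, done on the transpose, then lowers the size. *)
pose D : 'M_(m.+1, n.+1) := (block_mx b%:M (row i C) 0 C : 'M_(1 + m, 1 + n)).
have D0 : D 0 0 = b.
  transitivity ((b%:M : 'M_1) 0 0); last by rewrite !mxE mulr1n.
  by rewrite -(block_mxEul _ (row i C) 0 C); congr (D _ _); apply: val_inj.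
have BD : @equiv_mx (1 + m) (1 + n) B D.
  apply: (@equiv_mx_trans (1 + m) (1 + n) _ _ _ BC).
  exists (block_mx 1%:M (delta_mx 0 i) 0 1%:M : 'M_(1 + m)), 1%:M.
  split; rewrite ?unitmx1 //.
    by rewrite unitmxE det_ublock !det1 mulr1 unitr1.
  rewrite mulmx1 !mulmx_block !mul1mx !mul0mx !mulmx0 !addr0 !add0r.
  by rewrite -rowE.
have [||E DE sE] := @pivot_step _ _ D^T (lift ord0 j).
- by rewrite mxE D0.
- rewrite ![D^T _ _]mxE D0; suff -> : D 0 (lift ord0 j) = C i j by [].
  transitivity (row i C 0 j); last by rewrite mxE.
  by rewrite -(block_mxEur b%:M _ 0 C) -lift0E; congr (D _ _); apply: val_inj.
apply: (step E^T); last by move: sE; rewrite ![D^T _ _]mxE ![E^T _ _]mxE D0.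
by apply: equiv_mx_trans BD _; rewrite -[D]trmxK; apply: equiv_mx_tr.
Qed.

Lemma invariant_factorsE m n (A : 'M[{poly F}]_(m, n)) s :
  invariant_factors A s <->
  [/\ (size s <= minn m n)%N, all (fun d : {poly F} => d \is monic) s,
      sorted (fun d e : {poly F} => d %| e) s & equiv_mx A (diag_seq m n s)].
Proof. by []. Qed.

Lemma dvdp_equiv_mx m n (A B : 'M[{poly F}]_(m, n)) a :
  equiv_mx A B -> (forall i j, a %| A i j) -> forall i j, a %| B i j.
Proof.
move=> [U [V [_ _ <-]]] dA i j; rewrite mxE.
apply: (big_ind (fun q => a %| q)); rewrite ?dvdp0 //; first exact: dvdp_add.
move=> t _; rewrite mxE mulr_suml.
apply: (big_ind (fun q => a %| q)); rewrite ?dvdp0 //; first exact: dvdp_add.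
by move=> u _; rewrite dvdp_mulr // dvdp_mull.
Qed.

Lemma invariant_factors_exist m n (A : 'M[{poly F}]_(m, n)) :
  exists s, invariant_factors A s.
Proof.
have triv (B : 'M[{poly F}]_(m, n)) : B = 0 -> exists s, invariant_factors B s.
  move=> ->; exists [::]; apply/invariant_factorsE; split=> //.
  have -> : diag_seq m n [::] = 0 by apply/matrixP => i j; rewrite !mxE nth_nil mul0rn.
  exact: equiv_mx_refl.
elim: m n A triv => [|m IH] [|n] A triv.
- by apply: triv; apply: flatmx0.
- by apply: triv; apply: flatmx0.
- by apply: triv; apply: thinmx0.
have [/triv//|A0] := eqVneq A 0.
have [a [B [ma dB AB]]] := pivot_exists A0.
have [|s /invariant_factorsE[ss ms sos Bs]] := IH n B.
  move=> C ->; exists [::]; apply/invariant_factorsE; split=> //.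
  have -> : diag_seq m n [::] = 0 by apply/matrixP => i j; rewrite !mxE nth_nil mul0rn.
  exact: equiv_mx_refl.
exists (a :: s); apply/invariant_factorsE; split.
- by rewrite /= minnSS.
- by rewrite /= ma.
(* Common divisors of all entries survive equivalence, so [a] divides the first invariant factor of
   [B], the only new link of the chain. *)
- have := dvdp_equiv_mx Bs dB.
  case: s sos ss {ms Bs} => //= b s -> ss H; rewrite andbT.
  have m0 : (0 < m)%N by lia.
  have n0 : (0 < n)%N by lia.
  by have := H (Ordinal m0) (Ordinal n0); rewrite mxE /= mulr1n.
apply: (@equiv_mx_trans (1 + m) (1 + n) _ _ _ AB); case: Bs => U [V [uU uV BUV]].
exists (block_mx 1%:M 0 0 U : 'M_(1 + m)), (block_mx 1%:M 0 0 V : 'M_(1 + n)).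
split.
- by rewrite unitmxE det_lblock det1 mul1r -unitmxE.
- by rewrite unitmxE det_lblock det1 mul1r -unitmxE.
rewrite !mulmx_block !mul1mx !mul0mx !mulmx0 !addr0 !add0r !mul0mx mulmx1 BUV.
apply/matrixP => i j.
by case: (fintype.split_ordP (m := 1) i) => i' ->; case: (fintype.split_ordP (m := 1) j) => j' ->;
  rewrite ?block_mxEul ?block_mxEur ?block_mxEdl ?block_mxEdr !mxE ?ord1 //=.
Qed.

End Smith.

(** * Ranks, kernels and partial multiplicities from the Smith form *)

Lemma rank_diag (K : fieldType) (d : nat -> K) m n :
  \rank (\matrix_(i < m, j < n) (d i *+ (i == j :> nat))) =
  count (fun i => d i != 0) (iota 0 (minn m n)).
Proof.
elim: m n d => [|m IH] [|n] d; rewrite ?minn0 ?min0n ?minnSS.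
- by rewrite flatmx0 mxrank0.
- by rewrite flatmx0 mxrank0.
- by rewrite thinmx0 mxrank0.
rewrite /= -[1%N]/(1 + 0)%N iotaDl count_map.
rewrite -[count _ _]/(count (fun i => (d \o succn) i != 0) (iota 0 (minn m n))) -IH.
have <- : \rank ((d 0%N)%:M : 'M_1) = (d 0%N != 0).
  have [->|d0] := eqVneq (d 0%N) 0; first by rewrite raddf0 mxrank0.
  by rewrite -scalemx1 mxrank_scale_nz // mxrank1.
rewrite -rank_diag_block_mx; apply: (congr1 (fun A : 'M_(1 + m, 1 + n) => \rank A)).
apply/matrixP => i j.
by case: (fintype.split_ordP (m := 1) i) => i' ->;
  case: (fintype.split_ordP (m := 1) j) => j' ->;
  rewrite ?block_mxEul ?block_mxEur ?block_mxEdl ?block_mxEdr !mxE ?ord1 //=.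
Qed.

Lemma unitmx_map (R S : comUnitRingType) (phi : {rmorphism R -> S}) n
    (U : 'M[R]_n) : U \in unitmx -> map_mx phi U \in unitmx.
Proof. by rewrite !unitmxE det_map_mx; apply: rmorph_unit. Qed.

Section SmithRank.
Variable F : fieldType.
Implicit Types (s : seq {poly F}) (a : F).

Lemma count_nth_iota (T : Type) (x0 : T) (q : pred T) (s : seq T) :
  count (fun i => q (nth x0 s i)) (iota 0 (size s)) = count q s.
Proof. by rewrite -[in RHS](mkseq_nth x0 s) count_map. Qed.

(** Unimodular multipliers stay invertible under [phi], so only the diagonal counts. Used for
    evaluation at a point, for the embedding into F(z) and for the substitution of 1/z. *)
Lemma rank_map_smith (K : fieldType) (phi : {rmorphism {poly F} -> K}) m n
    (A : 'M[{poly F}]_(m, n)) s :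
  (size s <= minn m n)%N -> equiv_mx A (diag_seq m n s) ->
  \rank (map_mx phi A) = count (fun d => phi d != 0) s.
Proof.
move=> ss [U [V [uU uV E]]].
transitivity (\rank (map_mx phi (U *m A *m V))).
  rewrite !map_mxM /= mxrankMfree; last by rewrite row_free_unit unitmx_map.
  rewrite -[RHS]mxrank_tr trmx_mul mxrankMfree ?mxrank_tr //.
  by rewrite row_free_unit unitmx_tr unitmx_map.
rewrite E.
have -> : map_mx phi (diag_seq m n s) =
    \matrix_(i, j) (phi s`_i *+ (i == j :> nat)).
  by apply/matrixP => i j; rewrite !mxE rmorphMn.
rewrite (rank_diag (fun i => phi s`_i)) -(subnKC ss) iotaD count_cat.
rewrite (count_nth_iota 0 (fun d => phi d != 0)) [X in (_ + X)%N](@eq_in_count _ _ pred0).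
  by rewrite count_pred0 addn0.
by move=> i; rewrite mem_iota => /andP[si _]; rewrite nth_default // rmorph0 eqxx.
Qed.

Lemma rank_ratmx_smith m n (A : 'M[{poly F}]_(m, n)) s :
  invariant_factors A s -> \rank (ratmx A) = size s.
Proof.
case=> ss ms _ E; rewrite (rank_map_smith (@tofrac _) ss E).
apply/eqP; rewrite -all_count; apply/allP => d /(allP ms)/monic_neq0.
by rewrite /= tofrac_eq0.
Qed.

Lemma rank_map_inj (K : fieldType) (phi : {rmorphism {poly F} -> K}) m n
    (A : 'M[{poly F}]_(m, n)) :
  injective phi -> \rank (map_mx phi A) = \rank (ratmx A).
Proof.
move=> phi_inj; have [s sA] := invariant_factors_exist A.
rewrite (rank_ratmx_smith sA); case: sA => ss ms _ E.
rewrite (rank_map_smith phi ss E).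
apply/eqP; rewrite -all_count; apply/allP => d /(allP ms)/monic_neq0.
by apply: contraNneq => pd; apply/eqP/phi_inj; rewrite rmorph0.
Qed.

Lemma equiv_mx_rank (K : fieldType) (phi : {rmorphism {poly F} -> K}) m n
    (A B : 'M[{poly F}]_(m, n)) :
  equiv_mx A B -> \rank (map_mx phi A) = \rank (map_mx phi B).
Proof.
move=> AB; have [s [ss _ _ E]] := invariant_factors_exist B.
rewrite (rank_map_smith phi ss E) (rank_map_smith phi ss) //.
exact: equiv_mx_trans AB E.
Qed.

Lemma equiv_mx_eigenvalue m n (A B : 'M[{poly F}]_(m, n)) a :
  equiv_mx A B -> fin_eigenvalue A a <-> fin_eigenvalue B a.
Proof.
move=> AB; rewrite /fin_eigenvalue.
by rewrite !(equiv_mx_rank (horner_eval a) AB) (equiv_mx_rank (@tofrac _) AB).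
Qed.

Lemma equiv_mx_partial_mults m n (A B : 'M[{poly F}]_(m, n)) a l :
  equiv_mx A B -> fin_partial_mults A a l <-> fin_partial_mults B a l.
Proof.
move=> AB; split=> -[s [ss ms sos E] ->]; exists s => //; split=> //.
  exact: equiv_mx_trans (equiv_mx_sym AB) E.
exact: equiv_mx_trans AB E.
Qed.

Lemma fin_eigenvalue_smith m n (A : 'M[{poly F}]_(m, n)) s d a :
  invariant_factors A s -> d \in s -> root d a -> fin_eigenvalue A a.
Proof.
move=> sA ds da; rewrite /fin_eigenvalue (rank_ratmx_smith sA).
case: sA => ss _ _ E; rewrite (rank_map_smith (horner_eval a) ss E).
rewrite -(count_predC (fun d : {poly F} => horner_eval a d != 0)) -addn1 leq_add2l.
rewrite -has_count; apply/hasP; exists d => //=.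
by rewrite negbK; apply: da.
Qed.

(* The columns of [K] are those of the right Smith multiplier that correspond
   to zero invariant factors. *)
Lemma kernel_factor m r p (A : 'M[{poly F}]_(m, r + p)) :
  \rank (ratmx A) = r ->
  exists (K : 'M[{poly F}]_(r + p, p)) (K' : 'M[{poly F}]_(p, r + p)),
    [/\ A *m K = 0, K' *m K = 1%:M &
      forall f, (forall s d, invariant_factors A s -> d \in s -> coprimep f d) ->
      forall g : 'cV[{poly F}]_(r + p), (forall i, f %| (A *m g) i 0) ->
      forall j, f %| (g - K *m (K' *m g)) j 0].
Proof.
move=> rA; have [s sA] := invariant_factors_exist A.
have sz : size s = r by rewrite -(rank_ratmx_smith sA).
have [ss ms _ [U [V [uU uV E]]]] := sA.
exists (rsubmx V), (dsubmx (invmx V)); split.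
- have: U *m (A *m rsubmx V) = 0.
    rewrite mulmxA mulmx_rsub E; apply/matrixP => i j; rewrite !mxE /=.
    case: eqP => // ->; rewrite nth_default ?mul0rn // sz leq_addr //.
  by move/(congr1 (mulmx (invmx U))); rewrite mulKmx // mulmx0.
- rewrite mulmx_rsub mul_dsub_mx mulVmx //.
  by apply/matrixP => i j; rewrite !mxE (inj_eq (@rshift_inj _ _)).
move=> f cf g fg j.
(* In the coordinates [y] the first [r] components are multiplied by invariant factors coprime to
   [f], so [f] divides them; subtracting [K *m (K' *m g)] removes exactly the other [p]
   components. *)
pose y := invmx V *m g.
have dy i : f %| usubmx y i 0.
  have im : (i < m)%N.
    by apply: leq_trans (geq_minl m (r + p)); rewrite -[X in (X <= _)%N]/(i.+1) (leq_trans _ ss) // sz.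
  have: f %| (U *m A *m g) (Ordinal im) 0.
    rewrite -mulmxA mxE; apply: (big_ind (fun q => f %| q)); first exact: dvdp0.
      exact: dvdp_add.
    by move=> t _; rewrite dvdp_mull.
  have -> : U *m A *m g = diag_seq m (r + p) s *m y by rewrite /diag_seq -E /y -!mulmxA mulKVmx.
  rewrite mxE (bigD1 (lshift p i)) //= big1 => [|t ti].
    rewrite !mxE eqxx mulr1n addr0 Gauss_dvdpr //.
    by apply: (cf s) => //; rewrite mem_nth // sz /=.
  by rewrite !mxE eq_sym -[_ == _]/(t == lshift p i) (negPf ti) mul0r.
have -> : g - rsubmx V *m (dsubmx (invmx V) *m g) = lsubmx V *m usubmx y.
  rewrite mul_dsub_mx -/y; apply/eqP; rewrite subr_eq; apply/eqP.
  rewrite -mul_row_col hsubmxK vsubmxK /y mulKVmx //.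
rewrite mxE; apply: (big_ind (fun q => f %| q)); first exact: dvdp0.
  exact: dvdp_add.
by move=> t _; rewrite dvdp_mull.
Qed.

(* The values at [a] of the polynomial vectors [X] with [A X = 0] modulo
   [('X - a)^h]; their dimensions count the partial multiplicities. *)
Definition local_dim m n (A : 'M[{poly F}]_(m, n)) a h (e : nat) : Prop :=
  exists2 W : 'M[F]_n, \rank W = e &
    forall x : 'rV[F]_n, (x <= W)%MS <->
      exists2 X : 'rV[{poly F}]_n, x = map_mx (horner_eval a) X &
        forall i, ('X - a%:P) ^+ h %| (X *m A^T) 0 i.

Lemma local_dim_uniq m n (A : 'M[{poly F}]_(m, n)) a h e e' :
  local_dim A a h e -> local_dim A a h e' -> e = e'.
Proof.
move=> [W <- WP] [W' <- WP'].
suff /eqmx_rank -> : (W == W')%MS by [].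
by apply/andP; split; apply/row_subP => i; [apply/WP'/WP | apply/WP/WP'];
  apply: row_sub.
Qed.

Lemma dvdp_mulmx r m n (A : 'M[{poly F}]_(r, m)) (B : 'M[{poly F}]_(m, n)) f i :
  (forall j, f %| A i j) -> forall j, f %| (A *m B) i j.
Proof.
move=> fA j; rewrite mxE; apply: (big_ind (fun q => f %| q)).
- exact: dvdp0.
- exact: dvdp_add.
- by move=> t _; rewrite dvdp_mulr.
Qed.

(** In Smith coordinates the condition splits by components: a factor of multiplicity below [h]
    forces its coordinate to vanish at [a], and all other coordinates are free. *)
Lemma local_dim_smith m n (A : 'M[{poly F}]_(m, n)) s a h :
  invariant_factors A s ->
  local_dim A a h (n - count (fun d => (mup a d < h)%N) s).
Proof.
case=> ss ms _ [U [V [uU uV E]]].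
(* Indices from [size s] on stand for zero invariant factors; they are listed apart because [mup]
   does not measure the divisibility of the default 0. *)
pose good i := ((size s <= i) || (h <= mup a s`_i))%N.
pose G : 'M[F]_n := \matrix_(i, j) ((good i)%:R *+ (i == j :> nat)).
pose Va := map_mx (horner_eval a) V^T.
have uVa : Va \in unitmx by rewrite unitmx_map // unitmx_tr.
exists (G *m Va).
  rewrite mxrankMfree ?row_free_unit // (rank_diag (fun i => (good i)%:R)) minnn.
  rewrite (eq_count (a2 := good)) => [|i]; last by case: (good i); rewrite ?oner_eq0 ?eqxx.
  have sn : (size s <= n)%N := leq_trans ss (geq_minr _ _).
  rewrite -(subnKC sn) iotaD count_cat.
  rewrite (@eq_in_count _ _ predT (iota _ (n - size s))); last first.
    by move=> i; rewrite mem_iota add0n => /andP[si _]; rewrite /good si.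
  rewrite count_predT size_iota.
  rewrite (@eq_in_count _ _ (fun i => ~~ (mup a s`_i < h)%N)); last first.
    by move=> i; rewrite mem_iota /good -leqNgt => /andP[_ si]; rewrite leqNgt si.
  rewrite (count_nth_iota 0 (fun d => ~~ (mup a d < h)%N)).
  set c := count _ s; set c' := count _ s.
  have : (c + c' = size s)%N := count_predC _ s.
  by clearbody c c'; lia.
have EA : A^T = (invmx V)^T *m (diag_seq m n s)^T *m (invmx U)^T.
  rewrite -!trmx_mul; congr trmx; rewrite /diag_seq -E.
  by rewrite !mulmxA mulVmx // mul1mx mulmxK.
have dE (Y : 'rV[{poly F}]_n) (i : 'I_m) (ii : (i < n)%N) :
    (Y *m (diag_seq m n s)^T) 0 i = Y 0 (Ordinal ii) * s`_i.
  rewrite mxE (bigD1 (Ordinal ii)) //= big1 => [|t ti].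
    by rewrite !mxE eqxx mulr1n addr0.
  rewrite !mxE; case: eqP => [it|]; rewrite ?mulr0n ?mulr0 //.
  by case/eqP: ti; apply: val_inj.
move=> x; split=> [/submxP[y ->]|[X -> XA]].
  exists (map_mx polyC (y *m G) *m V^T).
    rewrite map_mxM mulmxA; congr (_ *m _).
    by apply/matrixP => i j; rewrite !mxE /= /horner_eval hornerC.
  move=> i; rewrite EA !mulmxA -(mulmxA _ V^T) -trmx_mul mulVmx // trmx1 mulmx1.
  apply: dvdp_mulmx => {}i.
  case: (ltnP i n) => [ii|ni]; last first.
    rewrite mxE big1 ?dvdp0 // => t _; rewrite !mxE.
    by case: eqP => [it|]; rewrite ?mulr0 //; have := ltn_ord t; lia.
  rewrite dE mxE mxE (bigD1 (Ordinal ii)) //= big1 => [|t ti]; last first.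
    rewrite !mxE; case: eqP => [it|]; rewrite ?mulr0n ?mulr0 //.
    by case/eqP: ti; apply: val_inj.
  rewrite !mxE eqxx mulr1n addr0 /good.
  case: (leqP (size s) i) => [si|si]; first by rewrite nth_default // mulr0 dvdp0.
  have s0 : s`_i != 0 by rewrite monic_neq0 //; apply: (allP ms); rewrite mem_nth.
  case: leqP => hs /=; last by rewrite mulr0 polyC0 mul0r dvdp0.
  by rewrite dvdp_mull // -mup_geq.
pose Y := X *m (invmx V)^T.
have YV : Y *m V^T = X by rewrite -mulmxA -trmx_mul mulmxV // trmx1 mulmx1.
have YA i : ('X - a%:P) ^+ h %| (Y *m (diag_seq m n s)^T) 0 i.
  have -> : Y *m (diag_seq m n s)^T = X *m A^T *m U^T.
    by rewrite EA -!mulmxA -(trmx_mul U) mulmxV // trmx1 mulmx1.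
  exact: dvdp_mulmx.
clearbody Y; suff YG : map_mx (horner_eval a) Y *m G = map_mx (horner_eval a) Y.
  apply/submxP; exists (map_mx (horner_eval a) Y).
  by rewrite mulmxA YG -map_mxM YV.
apply/matrixP => i j; rewrite ord1 mxE (bigD1 j) //= big1 => [|t tj]; last first.
  by rewrite [G t j]mxE -[_ == _ :> nat]/(t == j) (negPf tj) mulr0n mulr0.
rewrite !mxE eqxx mulr1n addr0; case: (boolP (good j)) => [_|]; first by rewrite mulr1.
rewrite negb_or -ltnNge -ltnNge => /andP[js hs]; rewrite mulr0; apply/esym/eqP.
have jm : (j < m)%N := leq_trans js (leq_trans ss (geq_minl _ _)).
have := YA (Ordinal jm); rewrite (dE _ (Ordinal jm) (ltn_ord j)) /=.
have -> : Ordinal (ltn_ord j) = j by apply: val_inj.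
have s0 : s`_j != 0 by rewrite monic_neq0 //; apply: (allP ms); rewrite mem_nth.
apply: contraTT => Yj.
have Y0 : Y 0 j != 0 by apply: contraNneq Yj => ->; rewrite /horner_eval horner0.
by rewrite -mup_ltn ?mulf_neq0 // mupMr.
Qed.

Lemma sorted_counts_eq (s t : seq nat) : sorted leq s -> sorted leq t ->
  (forall h, count (leq h) s = count (leq h) t) -> s = t.
Proof.
move=> ss st H; apply: (sorted_eq leq_trans anti_leq ss st).
have E (u : seq nat) x : (count_mem x u + count (leq x.+1) u = count (leq x) u)%N.
  elim: u => //= y u <-; case: ltngtP => _ /=; lia.
apply/allP => x _ /=; apply/eqP/(@addIn (count (leq x.+1) s)).
by rewrite E (H x.+1) E.
Qed.

Lemma sorted_mup s a : all (fun d : {poly F} => d \is monic) s ->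
  sorted (fun d e : {poly F} => d %| e) s -> sorted leq [seq mup a d | d <- s].
Proof.
move=> ms; rewrite sorted_map; apply: (sub_in_sorted (P := fun d : {poly F} => d \is monic)) => //.
move=> d e _ me; rewrite /= mup_geq ?monic_neq0 //; apply: dvdp_trans.
have [->|d0] := eqVneq d 0; first by rewrite dvdp0.
by rewrite -mup_geq.
Qed.

Lemma partial_mults_sorted m n (A : 'M[{poly F}]_(m, n)) a l :
  fin_partial_mults A a l -> sorted leq l.
Proof.
case=> s [_ ms sos _] ->; apply: sorted_filter; first exact: leq_trans.
exact: sorted_mup.
Qed.

(** The zero invariant factors contribute the nullity, and each factor of multiplicity at least [h]
    one more. Positivity of [h] matters because [l] has lost the zero multiplicities. *)
Lemma partial_mults_count m n (A : 'M[{poly F}]_(m, n)) a l h :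
  fin_partial_mults A a l -> (0 < h)%N ->
  local_dim A a h (n - \rank (ratmx A) + count (leq h) l).
Proof.
case=> s sA -> h0; have := local_dim_smith a h sA.
rewrite (rank_ratmx_smith sA).
have sn : (size s <= n)%N by case: sA => ss _ _ _; apply: leq_trans ss (geq_minr _ _).
have -> : count (leq h) [seq e <- [seq mup a d | d <- s] | (0 < e)%N] =
    count (fun d => ~~ (mup a d < h)%N) s.
  rewrite count_filter count_map; apply: eq_count => d /=.
  by rewrite -leqNgt; case: (leqP h) => // hd; rewrite (leq_trans h0 hd).
set c := count _ s; set c' := count _ s.
have : (c + c' = size s)%N := count_predC _ s.
clearbody c c' => cs; have -> // : (n - c = n - size s + c')%N by lia.
Qed.

(** [local_dim] is intrinsic, so the hypothesis transports the number of multiplicities at least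
    [h], the shift [nu] cancelling against that of the nullity; these numbers determine a sorted
    list. *)
Lemma partial_mults_eq m n m' n' (A : 'M[{poly F}]_(m, n))
    (B : 'M[{poly F}]_(m', n')) nu a l l' :
  (n' - \rank (ratmx B) = n - \rank (ratmx A) + nu)%N ->
  (forall h e, (0 < h)%N -> local_dim A a h e -> local_dim B a h (e + nu)) ->
  fin_partial_mults A a l -> fin_partial_mults B a l' -> l = l'.
Proof.
move=> rAB AB Al Bl.
(* For [h = 0] the count is the length, which equals the count for [h = 1] as all entries are
   positive. *)
have pos t k k' (C : 'M[{poly F}]_(k, k')) : fin_partial_mults C a t -> count (leq 0) t = count (leq 1) t.
  case=> s _ ->; rewrite !count_filter; apply: eq_count => e /=.
  by case: e.
have E h : (0 < h)%N -> count (leq h) l = count (leq h) l'.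
  move=> h0; apply/eqP; rewrite -(eqn_add2l (n - \rank (ratmx A) + nu)); apply/eqP.
  rewrite addnAC -[in RHS]rAB.
  apply: (local_dim_uniq (AB _ _ h0 (partial_mults_count Al h0))).
  exact: partial_mults_count.
apply: sorted_counts_eq => [||[|h]]; last exact: E.
- exact: partial_mults_sorted Al.
- exact: partial_mults_sorted Bl.
by rewrite (pos _ _ _ _ Al) (pos _ _ _ _ Bl) E.
Qed.

Lemma partial_mults_exist m n (A : 'M[{poly F}]_(m, n)) a :
  exists l, fin_partial_mults A a l.
Proof.
have [s sA] := invariant_factors_exist A.
by exists [seq e <- [seq mup a d | d <- s] | (0 < e)%N]; exists s.
Qed.

Lemma partial_mults_nil m n (A : 'M[{poly F}]_(m, n)) a l :
  ~ fin_eigenvalue A a -> fin_partial_mults A a l -> l = [::].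
Proof.
move=> nA [s sA ->]; apply/eqP; rewrite -size_eq0 -[_ == _]negbK -lt0n -has_predT.
apply/hasPn => e; rewrite mem_filter => /andP[e0 /mapP[d ds de]].
case: nA; apply: (fin_eigenvalue_smith sA ds).
by apply: contraTT e0 => /mupNroot; rewrite de => ->.
Qed.

End SmithRank.

(** * Coefficients of DL(P, v) *)

Lemma big_mxtens (V : nmodType) (k q : nat) (f : 'I_(k * q) -> V) :
  \sum_t f t = \sum_(i < k) \sum_(c < q) f (mxtens_index (i, c)).
Proof.
rewrite pair_big /= (reindex (@mxtens_index k q)); first by apply: eq_bigr => -[].
by exists (@mxtens_unindex k q) => u _; rewrite (mxtens_indexK, mxtens_unindexK).
Qed.

Section Bezout.
Variable F : fieldType.
Implicit Types (p v f : {poly F}).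

(* [bez p v I.+1] is the coefficient of [y^I] in
   [(p(y) v(x) - p(x) v(y)) / (x - y)], and [bez p v 0 = 0]. *)
Definition bez p v I := p * drop_poly I v - v * drop_poly I p.

Lemma drop_polyS f I : drop_poly I f = (f`_I)%:P + 'X * drop_poly I.+1 f.
Proof.
apply/polyP => -[|i]; rewrite !(coef_drop_poly, coefD, coefC, coefXM) /= ?addr0 //.
by rewrite add0r addSnnS.
Qed.

(** The product of the two high parts cancels; what is left displays the degree bound that the
    definition of [bez] hides. *)
Lemma bezE p v I : bez p v I = take_poly I p * drop_poly I v - take_poly I v * drop_poly I p.
Proof.
rewrite /bez -{1}(poly_take_drop I p) -{2}(poly_take_drop I v); ring.
Qed.

Lemma bez0 p v : bez p v 0 = 0.
Proof. by rewrite /bez !drop_poly0l mulrC subrr. Qed.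

Lemma bezS p v I : bez p v I = 'X * bez p v I.+1 + p * (v`_I)%:P - v * (p`_I)%:P.
Proof. by rewrite /bez 2!(drop_polyS _ I); ring. Qed.

Lemma coef_bezS p v I J :
  (bez p v I)`_J = ('X * bez p v I.+1)`_J + p`_J * v`_I - v`_J * p`_I.
Proof. by rewrite bezS; move: (bez p v I.+1) => B; rewrite coefB coefD !coefMC. Qed.

Lemma size_bez k p v I : (size p <= k.+1)%N -> (size v <= k)%N ->
  (size (bez p v I) <= k)%N.
Proof.
move=> sp sv; case: (leqP I k) => Ik; last first.
  by rewrite /bez !drop_poly_eq0 ?mulr0 ?subrr ?size_poly0 //; lia.
have H (f g : {poly F}) : (size f <= I)%N -> (size g <= k.+1 - I)%N -> (size (f * g)%R <= k)%N.
  move=> sf sg; apply: leq_trans (size_polyMleq _ _) _; lia.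
rewrite bezE (leq_trans (size_polyD _ _)) // size_polyN geq_max.
rewrite !H ?size_take_poly // size_drop_poly; first exact: leq_sub2r.
by rewrite leq_sub2r // leqW.
Qed.

(** With [bez0], the boundary values of the recurrence [bezS]: sums over [I] telescope between them,
    and descending inductions start here. *)
Lemma bez_last k p v : (size p <= k.+1)%N -> (size v <= k)%N ->
  bez p v k = - (v * (p`_k)%:P).
Proof.
move=> sp sv; rewrite bezS /bez (drop_poly_eq0 sp) (drop_poly_eq0 (leqW sv)) (nth_default 0 sv).
by rewrite polyC0 !mulr0 subrr mulr0 !add0r.
Qed.

(* The coefficient of [y^I x^J] in
   [p(y) v(x) + (y - z) (p(y) v(x) - p(x) v(y)) / (x - y)], an equivalent form of
   the right-hand side of the identity defining DL(p, v). *)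
Definition dl_coef p v I J : {poly F} :=
  (v`_J * p`_I + (bez p v I)`_J)%:P - (bez p v I.+1)`_J *: 'X.

Definition DLmx k m n (P : 'M[{poly F}]_(m, n)) v : 'M[{poly F}]_(k * m, k * n) :=
  \matrix_(s, t) let s' := mxtens_unindex s in let t' := mxtens_unindex t in
    dl_coef (P s'.2 t'.2) v (k.-1 - s'.1) (k.-1 - t'.1).

Lemma DLmxE k m n (P : 'M[{poly F}]_(m, n)) v (i j : 'I_k) (a : 'I_m) (b : 'I_n) :
  DLmx k P v (mxtens_index (i, a)) (mxtens_index (j, b)) =
  dl_coef (P a b) v (k.-1 - i) (k.-1 - j).
Proof. by rewrite mxE !mxtens_indexK. Qed.

Lemma sum_rev_ord (V : nmodType) k (f : nat -> V) :
  \sum_(i < k) f (k.-1 - i)%N = \sum_(i < k) f i.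
Proof.
rewrite (reindex_inj rev_ord_inj); apply: eq_bigr => i _ /=; congr f.
by have := ltn_ord i; lia.
Qed.

Lemma horner_alg_wide (A : comAlgType F) (x : A) d f : (size f <= d)%N ->
  horner_alg x f = \sum_(i < d) f`_i *: x ^+ i.
Proof.
move=> sf; rewrite /horner_alg /horner_morph (horner_coef_wide _ (n := d)).
  by apply: eq_bigr => i _; rewrite coef_map /= -scalerAl mul1r.
by rewrite (leq_trans (size_poly _ _)).
Qed.

(** Horner's scheme: the [drop_poly I.+1 f] are the coefficients, in powers of [y], of the divided
    difference of [f]. The truncated version [H] carries the error term that makes the induction
    work. *)
Lemma sum_drop_polyM (A : comAlgType F) (x y : A) d f : (size f <= d.+1)%N ->
  (x - y) * (\sum_(I < d) y ^+ I * horner_alg x (drop_poly I.+1 f)) =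
  horner_alg x f - horner_alg y f.
Proof.
have H e : (x - y) * (\sum_(I < e) y ^+ I * horner_alg x (drop_poly I.+1 f)) =
    horner_alg x f - \sum_(I < e) f`_I *: y ^+ I - y ^+ e * horner_alg x (drop_poly e f).
  elim: e => [|e IH]; first by rewrite !big_ord0 mulr0 drop_poly0l mul1r subr0 subrr.
  rewrite !big_ord_recr /= mulrDr IH.
  rewrite (drop_polyS f e) rmorphD rmorphM /= horner_algX horner_algC exprS.
  rewrite -[f`_e *: y ^+ e]mulr_algl; ring.
move=> sf; rewrite H (@horner_alg_wide _ y d.+1) // big_ord_recr /=.
rewrite (drop_polyS f d) (drop_poly_eq0 sf) mulr0 addr0 horner_algC.
by rewrite -[f`_d *: y ^+ d]mulr_algl; ring.
Qed.

Lemma DLmx_identity (A : comAlgType F) (x y z : A) k m n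
    (P : 'M[{poly F}]_(m, n)) v : has_grade k P -> (size v <= k)%N ->
  DL_identity x y z P v (DLmx k P v).
Proof.
move=> gP sv; apply/DL_identityE => a b; set p := P a b.
have sp : (size p <= k.+1)%N := gP a b.
(* The quotient by x - y also equals p(x) v(y) + (x - z) Bez(x, y), with Bez the Bezoutian; this is
   its part in y^I, obtained from [bezS]. *)
have row I : \sum_(J < k) y ^+ I * horner_alg z (dl_coef p v I J) * x ^+ J =
    (x - z) * (y ^+ I * horner_alg x (bez p v I.+1)) +
    horner_alg x p * (v`_I *: y ^+ I).
  transitivity (y ^+ I * (horner_alg x (v * (p`_I)%:P + bez p v I)
     - z * horner_alg x (bez p v I.+1))).
    rewrite !(@horner_alg_wide _ x k) ?size_bez //; last first.
      rewrite (leq_trans (size_polyD _ _)) // geq_max size_bez // andbT.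
      by rewrite mulrC mul_polyC (leq_trans (size_scale_leq _ _)).
    rewrite mulr_sumr -sumrB mulr_sumr; apply: eq_bigr => J _.
    rewrite /dl_coef -mul_polyC rmorphB rmorphM /= !horner_algC horner_algX.
    have -> : (v * (p`_I)%:P + bez p v I)`_J = v`_J * p`_I + (bez p v I)`_J.
      by rewrite [LHS]coefD coefMC.
    by rewrite -!(mulr_algl _ (x ^+ J)); ring.
  rewrite (bezS p v I); move: (bez p v I.+1) => B.
  rewrite !(rmorphD, rmorphN, rmorphM) /= horner_algX !horner_algC.
  by rewrite -(mulr_algl v`_I (y ^+ I)); ring.
under eq_bigr => i _ do under eq_bigr => j _ do rewrite DLmxE.
rewrite (@sum_rev_ord _ k (fun I => \sum_(j < k) y ^+ I *
   horner_alg z (dl_coef p v I (k.-1 - j)) * x ^+ (k.-1 - j))).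
under eq_bigr => I _ do rewrite (@sum_rev_ord _ k (fun J => y ^+ I *
   horner_alg z (dl_coef p v I J) * x ^+ J)) row.
rewrite big_split /= -!mulr_sumr -(horner_alg_wide _ sv).
have -> : \sum_(I < k) y ^+ I * horner_alg x (bez p v I.+1) =
   horner_alg x p * (\sum_(I < k) y ^+ I * horner_alg x (drop_poly I.+1 v)) -
   horner_alg x v * (\sum_(I < k) y ^+ I * horner_alg x (drop_poly I.+1 p)).
  rewrite !mulr_sumr -sumrB; apply: eq_bigr => I _.
  by rewrite /bez rmorphB !rmorphM /=; ring.
have Ev := @sum_drop_polyM _ x y k v (leqW sv).
have Ep := @sum_drop_polyM _ x y k p sp.
set Sv := \sum_(I < k) _ in Ev *; set Sp := \sum_(I < k) _ in Ep *.
transitivity ((x - z) * (horner_alg x p * ((x - y) * Sv) - horner_alg x v * ((x - y) * Sp))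
  + (x - y) * (horner_alg x p * horner_alg y v)); first by ring.
by rewrite Ev Ep; ring.
Qed.

Lemma DLmx_grade k m n (P : 'M[{poly F}]_(m, n)) v : has_grade 1 (DLmx k P v).
Proof.
move=> s t; rewrite mxE /dl_coef (leq_trans (size_polyD _ _)) // geq_max.
rewrite (leq_trans (size_polyC_leq1 _)) // size_polyN.
by rewrite (leq_trans (size_scale_leq _ _)) // size_polyX.
Qed.

Lemma is_DL_DLmx k m n (P : 'M[{poly F}]_(m, n)) v :
  has_grade k P -> (size v <= k)%N -> is_DL P v (DLmx k P v).
Proof. by move=> gP sv; split; [apply: DLmx_grade | apply: DLmx_identity]. Qed.

(** Exchanging [x] and [y] changes the sign of both sides of the identity, so the transpose
    satisfies it for [P^T], and uniqueness applies. *)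
Lemma trmx_DLmx k m n (P : 'M[{poly F}]_(m, n)) v :
  has_grade k P -> (size v <= k)%N -> (DLmx k P v)^T = DLmx k P^T v.
Proof.
move=> gP sv; have gPT : has_grade k P^T by move=> i j; rewrite mxE.
have idT (A : comAlgType F) (x y z : A) : DL_identity x y z P^T v (DLmx k P v)^T.
  apply/DL_identityE => b a; rewrite mxE.
  have /DL_identityE/(_ a b) := DLmx_identity y x z gP sv.
  rewrite exchange_big /= => E.
  transitivity (- ((y - z) * horner_alg y v * horner_alg x (P a b) -
    (x - z) * horner_alg x v * horner_alg y (P a b))); last by ring.
  rewrite -E -mulNr opprB; congr (_ * _).
  by apply: eq_bigr => i _; apply: eq_bigr => j _; rewrite mxE; ring.
apply: (@DL_unique F k n m P^T v); last exact: is_DL_DLmx.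
by split=> [i j|]; [rewrite mxE; apply: DLmx_grade | apply: idT].
Qed.

End Bezout.

(** * Reversal *)

Section Reversal.
Variable F : fieldType.
Implicit Types (p v f : {poly F}).

Definition revp g f : {poly F} := \poly_(i < g.+1) f`_(g - i).

Lemma size_revp g f : (size (revp g f) <= g.+1)%N.
Proof. exact: size_poly. Qed.

(** The correction term is due to the different grades k and k - 1: with X = 1/x and Y = 1/y, the
    Bezoutian of the reversals is -x^(k-1) y^(k-1) (p(Y) v(X) + Y Bez(X, Y)). *)
Lemma bez_rev k p v I J : (size p <= k.+1)%N -> (size v <= k)%N ->
  (I <= k)%N -> (J < k)%N ->
  (bez (revp k p) (revp k.-1 v) I)`_J =
  - ((revp k.-1 v)`_J * (revp k p)`_I) - (bez p v (k - I))`_(k.-1 - J).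
Proof.
move=> sp sv; have sp' := size_revp k p; have sv' := size_revp k.-1 v.
elim: I J => [|I IH] J Ik Jk.
  rewrite bez0 subn0 (bez_last sp sv) coefN coefMC opprK coef0 !coef_poly ltn0Sn subn0.
  have -> : (J < k.-1.+1)%N = true by lia.
  by rewrite addNr.
have sv'' : (size (revp k.-1 v) <= k)%N by rewrite (leq_trans sv') //; lia.
have E1 : (bez (revp k p) (revp k.-1 v) I.+1)`_J = (bez (revp k p) (revp k.-1 v) I)`_J.+1
    - (revp k p)`_J.+1 * (revp k.-1 v)`_I + (revp k.-1 v)`_J.+1 * (revp k p)`_I.
  rewrite [in RHS]coef_bezS coefXM /=; ring.
have {}IH : (bez (revp k p) (revp k.-1 v) I)`_J.+1 =
  - ((revp k.-1 v)`_J.+1 * (revp k p)`_I) - ('X * bez p v (k - I))`_(k.-1 - J).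
  rewrite coefXM; case: (ltnP J.+1 k) => Jk'.
    rewrite IH ?(ltnW Ik) //.
    have -> : (k.-1 - J == 0)%N = false by lia.
    by have -> : (k.-1 - J).-1 = (k.-1 - J.+1)%N by lia.
  have -> : (k.-1 - J == 0)%N by lia.
  rewrite [in LHS]nth_default ?(leq_trans _ Jk') ?size_bez //.
  by rewrite subr0 [X in - (X * _)]nth_default ?(leq_trans sv'') // mul0r oppr0.
rewrite E1 IH [(bez p v (k - I.+1))`_ _]coef_bezS.
have -> : (k - I.+1).+1 = (k - I)%N by lia.
have c1 : (revp k p)`_J.+1 = p`_(k.-1 - J).
  by rewrite coef_poly ifT; [congr p`_ _; lia | lia].
have c2 : (revp k.-1 v)`_I = v`_(k - I.+1).
  by rewrite coef_poly ifT; [congr v`_ _; lia | lia].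
have c3 : (revp k.-1 v)`_J = v`_(k.-1 - J).
  by rewrite coef_poly ifT //; lia.
have c4 : (revp k p)`_I.+1 = p`_(k - I.+1).
  by rewrite coef_poly ifT //; lia.
by rewrite c1 c2 c3 c4; ring.
Qed.

(** The correction term of [bez_rev] cancels the product in the constant coefficient and supplies
    the product required in the other one, so the two coefficients are exchanged. *)
Lemma dl_coef_rev k p v I J : (size p <= k.+1)%N -> (size v <= k)%N ->
  (I < k)%N -> (J < k)%N ->
  dl_coef (revp k p) (revp k.-1 v) I J = revp 1 (dl_coef p v (k.-1 - I) (k.-1 - J)).
Proof.
move=> sp sv Ik Jk.
have c (a b : F) : revp 1 (a%:P - b *: 'X) = (- b)%:P - (- a) *: 'X.
  apply/polyP => -[|[|i]]; rewrite !(coef_poly, coefD, coefN, coefC, coefZ, coefX) /=; ring.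
have c1 t : (t < k)%N -> (revp k.-1 v)`_t = v`_(k.-1 - t).
  by move=> tk; rewrite coef_poly ifT //; lia.
have c2 : (revp k p)`_I.+1 = p`_(k.-1 - I).
  by rewrite coef_poly ifT; [congr p`_ _; lia | lia].
rewrite /dl_coef c !bez_rev // ?(ltnW Ik) //; congr (_%:P - _ *: _).
  have -> : (k.-1 - I).+1 = (k - I)%N by lia.
  by ring.
rewrite c1 // c2.
have -> : (k.-1 - I)%N = (k - I.+1)%N by lia.
ring.
Qed.

Definition rev_block k q (s : 'I_(k * q)) : 'I_(k * q) :=
  let s' := mxtens_unindex s in mxtens_index (rev_ord s'.1, s'.2).

Lemma rev_blockK k q : involutive (@rev_block k q).
Proof.
move=> s; case: (mxtens_indexP s) => i a.
by rewrite /rev_block !mxtens_indexK /= rev_ordK.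
Qed.

Lemma equiv_mx_mxsub m n (f : 'I_m -> 'I_m) (g : 'I_n -> 'I_n)
    (A : 'M[{poly F}]_(m, n)) : injective f -> injective g ->
  equiv_mx A (mxsub f g A).
Proof.
move=> fi gi.
have -> : mxsub f g A = row_perm (perm fi) (col_perm (perm gi) A).
  by apply/matrixP => i j; rewrite !mxE !permE.
rewrite row_permE col_permE.
apply: equiv_mx_trans (equiv_mx_mull _ _); last exact: unitmx_perm.
by apply: equiv_mx_mulr; apply: unitmx_perm.
Qed.

Lemma DLmx_rev k m n (P : 'M[{poly F}]_(m, n)) v :
  has_grade k P -> (size v <= k)%N ->
  equiv_mx (revmx 1 (DLmx k P v)) (DLmx k (revmx k P) (revp k.-1 v)).
Proof.
move=> gP sv.
have -> : DLmx k (revmx k P) (revp k.-1 v) =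
    mxsub (@rev_block k m) (@rev_block k n) (revmx 1 (DLmx k P v)).
  apply/matrixP => s t; rewrite [in RHS]mxE [in RHS]mxE.
  case: (mxtens_indexP s) => i a; case: (mxtens_indexP t) => j b.
  rewrite DLmxE /rev_block !mxtens_indexK /= DLmxE mxE -/(revp k (P a b)).
  have ik := ltn_ord i; have jk := ltn_ord j.
  rewrite dl_coef_rev ?gP //; [|lia|lia]; congr (revp 1 (dl_coef _ _ _ _)) => /=; lia.
by apply: equiv_mx_mxsub; apply: inv_inj; apply: rev_blockK.
Qed.

Lemma revmx_grade g m n (P : 'M[{poly F}]_(m, n)) : has_grade g (revmx g P).
Proof. by move=> i j; rewrite mxE; apply: size_poly. Qed.

(* Substituting [1/z] for [z] is an injective morphism into [F(z)]. *)
Lemma rank_revmx g m n (A : 'M[{poly F}]_(m, n)) :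
  has_grade g A -> \rank (ratmx (revmx g A)) = \rank (ratmx A).
Proof.
move=> gA.
pose c := (@tofrac {poly F}) \o polyC.
pose x : {fraction {poly F}} := tofrac 'X.
have x0 : x != 0 by rewrite tofrac_eq0 polyX_eq0.
pose phi := horner_morph (fun a => mulrC (x^-1) (c a)).
have phiE d f : (size f <= d.+1)%N -> tofrac (revp d f) = x ^+ d * phi f.
  move=> sf; rewrite /phi /horner_morph (horner_coef_wide _ (n := d.+1)); last first.
    by rewrite (leq_trans (size_poly _ _)).
  rewrite /revp poly_def rmorph_sum mulr_sumr (reindex_inj rev_ord_inj).
  apply: eq_bigr => i _ /=; rewrite coef_map /= subSS.
  have id : (i <= d)%N by rewrite -ltnS.
  rewrite subKn // -mul_polyC rmorphM rmorphXn /= mulrCA; congr (_ * _).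
  by rewrite -/x exprVn -expfB_cond ?(negPf x0).
have phi_inj : injective phi.
  apply: raddf_inj => f /= f0; apply/polyP => i; rewrite coef0.
  have := phiE _ _ (leqW (leqnn (size f))); rewrite [phi f]f0 mulr0 => /eqP.
  rewrite tofrac_eq0 => /eqP/polyP/(_ (size f - i)%N); rewrite coef0 coef_poly.
  case: (ltnP i (size f)) => si; last by move=> _; rewrite nth_default.
  by rewrite ltnS leq_subr subKn ?(ltnW si).
rewrite -(rank_map_inj A phi_inj).
have -> : ratmx (revmx g A) = x ^+ g *: map_mx phi A.
  by apply/matrixP => i j; rewrite !mxE -phiE.
by apply: mxrank_scale_nz; rewrite expf_neq0.
Qed.

End Reversal.

(** * The pencil acting on functionals *)

Section Ansatz.
Variables (F : fieldType) (k m n : nat) (P : 'M[{poly F}]_(m, n)) (v : {poly F}).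

(* A row vector [w] of length [k * n] is viewed as [n] linear functionals
   [ev w _ b] on the polynomials of degree less than [k]; the next two matrices
   express that they vanish at [v] and at the Bezoutian coefficients. *)
Definition ansatz_mx : 'M[F]_(k * n, n) :=
  \matrix_(s, b) (v`_(k.-1 - (mxtens_unindex s).1) *+ ((mxtens_unindex s).2 == b)).

Definition bezout_mx : 'M[F]_(k * n, k * m) :=
  \matrix_(s, t) let s' := mxtens_unindex s in let t' := mxtens_unindex t in
    (bez (P t'.2 s'.2) v (k.-1 - t'.1).+1)`_(k.-1 - s'.1).

(** Its left kernel is the space N. All entries are constants, hence the one number [core_nullity]
    serves at every point and over F(z). *)
Definition core_mx : 'M[F]_(k * n, n + k * m) := row_mx ansatz_mx bezout_mx.

Definition core_nullity : nat := k * n - \rank core_mx.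

Section Action.
Variables (A : comNzRingType) (phi : {rmorphism {poly F} -> A}).
Implicit Types (w : 'rV[A]_(k * n)) (u : 'rV[A]_n) (f g : {poly F}).

(** [phi] will be the evaluation at a point, the embedding into F(z), or the identity of F[z], the
    last one for polynomial kernel vectors. *)
Definition cst : {rmorphism F -> A} := phi \o polyC.

Definition ev w f (b : 'I_n) : A :=
  \sum_(j < k) phi (f`_(k.-1 - j))%:P * w 0 (mxtens_index (j, b)).

Lemma evN w f b : ev w (- f) b = - ev w f b.
Proof.
by rewrite -sumrN; apply: eq_bigr => j _; rewrite coefN !rmorphN mulNr.
Qed.

Lemma evMC w f c b : ev w (f * c%:P) b = phi c%:P * ev w f b.
Proof.
rewrite mulr_sumr; apply: eq_bigr => j _.
by rewrite coefMC polyCM rmorphM /=; ring.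
Qed.

Lemma ev0 w b : ev w 0 b = 0.
Proof. by rewrite /ev big1 // => j _; rewrite coef0 polyC0 rmorph0 mul0r. Qed.

Lemma mul_ansatz_mx w b : (w *m map_mx cst ansatz_mx) 0 b = ev w v b.
Proof.
rewrite mxE big_mxtens; apply: eq_bigr => j _; rewrite (bigD1 b) //= big1.
  by rewrite !mxE !mxtens_indexK eqxx addr0 mulr1n mulrC.
by move=> c cb; rewrite !mxE !mxtens_indexK (negPf cb) mulr0n rmorph0 mulr0.
Qed.

Definition bez_ev w (a : 'I_m) I : A := \sum_b ev w (bez (P a b) v I) b.

Lemma mul_bezout_mx w i a :
  (w *m map_mx cst bezout_mx) 0 (mxtens_index (i, a)) = bez_ev w a (k.-1 - i).+1.
Proof.
rewrite mxE big_mxtens exchange_big; apply: eq_bigr => b _; apply: eq_bigr => j _.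
by rewrite !mxE !mxtens_indexK mulrC.
Qed.

Lemma mul_DLmx w i a :
  (w *m (map_mx phi (DLmx k P v))^T) 0 (mxtens_index (i, a)) =
  \sum_b phi ((P a b)`_(k.-1 - i))%:P * ev w v b +
  bez_ev w a (k.-1 - i) - phi 'X * bez_ev w a (k.-1 - i).+1.
Proof.
rewrite mxE big_mxtens exchange_big mulr_sumr -big_split -sumrB.
apply: eq_bigr => b _; rewrite /ev !mulr_sumr -big_split -sumrB.
apply: eq_bigr => j _; rewrite !mxE !mxtens_indexK /dl_coef /=.
rewrite -mul_polyC !(rmorphD, rmorphN, rmorphM) /=; ring.
Qed.

Hypotheses (gP : has_grade k P) (sv : (size v <= k)%N).

Lemma bez_ev0 w a : bez_ev w a 0 = 0.
Proof. by rewrite /bez_ev big1 // => b _; rewrite bez0 ev0. Qed.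

Lemma bez_ev_last w a :
  bez_ev w a k = - \sum_b phi ((P a b)`_k)%:P * ev w v b.
Proof.
rewrite -sumrN; apply: eq_bigr => b _.
by rewrite (bez_last (gP a b) sv) evN evMC.
Qed.

(* [powers q] is [V(z) (x) I_q], transposed. *)
Definition powers q : 'M[A]_(q, k * q) :=
  \matrix_(b, t) (phi 'X ^+ (k.-1 - (mxtens_unindex t).1) *+
                  (b == (mxtens_unindex t).2)).

Lemma phi_coef d f : (size f <= d)%N ->
  phi f = \sum_(i < d) phi (f`_i)%:P * phi 'X ^+ i.
Proof.
move=> sf; rewrite -{1}[f](coefK) (poly_def) (big_ord_widen _ (fun i => f`_i *: 'X^i) sf).
rewrite big_mkcond rmorph_sum; apply: eq_bigr => i _.
rewrite -rmorphXn -rmorphM mul_polyC; case: ltnP => // si.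
by rewrite nth_default // scale0r.
Qed.

(** Putting y = z in the action formula removes the Bezoutian term and leaves P(z) applied to w(v).
    Being a matrix identity, it also applies to kernels modulo an ideal. *)
Lemma DLmx_left : map_mx cst ansatz_mx *m (map_mx phi P)^T =
  (map_mx phi (DLmx k P v))^T *m (powers m)^T.
Proof.
apply/row_matrixP => s; rewrite !row_mul.
pose w : 'rV[A]_(k * n) := delta_mx 0 s.
have -> : row s (map_mx cst ansatz_mx) = w *m map_mx cst ansatz_mx by rewrite rowE.
have -> : row s (map_mx phi (DLmx k P v))^T = w *m (map_mx phi (DLmx k P v))^T by rewrite rowE.
apply/rowP => a.
transitivity (\sum_(I < k) phi 'X ^+ I * (\sum_b phi ((P a b)`_I)%:P * ev w v b +
  bez_ev w a I - phi 'X * bez_ev w a I.+1)).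
  (* The Bezoutian terms telescope: the one at 0 vanishes, and the one at [k] supplies the missing
     top coefficient of [P]. *)
  have -> : \sum_(I < k) phi 'X ^+ I * (\sum_b phi ((P a b)`_I)%:P * ev w v b +
    bez_ev w a I - phi 'X * bez_ev w a I.+1) =
    \sum_(I < k) phi 'X ^+ I * \sum_b phi ((P a b)`_I)%:P * ev w v b
    - phi 'X ^+ k * bez_ev w a k.
    elim: (k) => [|K IH]; first by rewrite !big_ord0 bez_ev0 mulr0 subrr.
    by rewrite !big_ord_recr IH /= exprS; ring.
  rewrite bez_ev_last mulrN opprK.
  transitivity (\sum_(I < k.+1) phi 'X ^+ I * \sum_b phi ((P a b)`_I)%:P * ev w v b); last first.
    by rewrite big_ord_recr.
  rewrite mxE; under [RHS]eq_bigr => I _ do rewrite mulr_sumr.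
  rewrite exchange_big; apply: eq_bigr => b _ /=.
  rewrite mul_ansatz_mx !mxE (phi_coef (gP a b)) mulr_sumr; apply: eq_bigr => I _; ring.
rewrite mxE big_mxtens -(sum_rev_ord k (fun I => phi 'X ^+ I * (\sum_b phi ((P a b)`_I)%:P * ev w v b +
  bez_ev w a I - phi 'X * bez_ev w a I.+1))).
apply: eq_bigr => i _; rewrite [RHS](bigD1 a) //= [X in _ = _ + X]big1.
  by rewrite mul_DLmx !mxE mxtens_indexK eqxx addr0 mulr1n mulrC.
by move=> c ca; rewrite !mxE mxtens_indexK eq_sym (negPf ca) mulr0n mulr0.
Qed.

(** [S] is an ideal: zero, or the multiples of (z - a)^h. Once w(v) = 0, the rows of the pencil read
    B_I - z B_(I+1) with B_I = [bez_ev w a I] and B_k = 0, so descending induction puts every B_I in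
    [S]. *)
Lemma bezout_ideal (S : A -> Prop) w : S 0 -> (forall x y, S x -> S y -> S (x + y)) ->
  (forall c x, S x -> S (c * x)) ->
  w *m map_mx cst ansatz_mx = 0 ->
  (forall t, S ((w *m (map_mx phi (DLmx k P v))^T) 0 t)) ->
  forall t, S ((w *m map_mx cst bezout_mx) 0 t).
Proof.
move=> S0 SD SM wv Sw.
have ev_v b : ev w v b = 0 by rewrite -mul_ansatz_mx wv mxE.
have Sc a d : S (bez_ev w a (k - d)).
  elim: d => [|d IH].
    by rewrite subn0 bez_ev_last big1 ?oppr0 // => b _; rewrite ev_v mulr0.
  case: (leqP k d) => kd.
    have -> : (k - d.+1)%N = 0%N by lia.
    by rewrite bez_ev0.
  have id : (d < k)%N by [].
  have := Sw (mxtens_index (Ordinal id, a)); rewrite mul_DLmx /=.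
  rewrite big1 ?add0r => [|b _]; last by rewrite ev_v mulr0.
  have -> : (k.-1 - d)%N = (k - d.+1)%N by lia.
  have -> : (k - d.+1).+1 = (k - d)%N by lia.
  move=> H; rewrite -[bez_ev _ _ _](subrK (phi 'X * bez_ev w a (k - d))).
  by apply: SD => //; apply: SM.
move=> t; case: (mxtens_indexP t) => i a; rewrite mul_bezout_mx.
have -> : (k.-1 - i).+1 = (k - i)%N by have := ltn_ord i; lia.
exact: Sc.
Qed.

Lemma core_mxP w : w *m map_mx cst core_mx = 0 <->
  w *m map_mx cst ansatz_mx = 0 /\ w *m (map_mx phi (DLmx k P v))^T = 0.
Proof.
rewrite map_row_mx mul_mx_row; split=> [H|[wv wL]].
  have [wv wb] : w *m map_mx cst ansatz_mx = 0 /\ w *m map_mx cst bezout_mx = 0.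
    by apply: eq_row_mx; rewrite H row_mx0.
  split=> //; apply/rowP => t; rewrite [RHS]mxE; case: (mxtens_indexP t) => i a.
  have ev_v b : ev w v b = 0 by rewrite -mul_ansatz_mx wv mxE.
  rewrite mul_DLmx -mul_bezout_mx wb mxE mulr0 subr0.
  rewrite big1 ?add0r => [|b _]; last by rewrite ev_v mulr0.
  (* [core_mx] records the Bezoutian coefficients of index 1 to [k]; the one of index 0 vanishes
     identically. *)
  case: (posnP (k.-1 - i)) => [->|ki]; first by rewrite bez_ev0.
  have ik : ((i.+1 : nat) < k)%N by lia.
  have := mul_bezout_mx w (Ordinal ik) a; rewrite wb mxE => -> /=; congr bez_ev; lia.
rewrite wv; have -> : w *m map_mx cst bezout_mx = 0; last by rewrite row_mx0.
apply/rowP => t; rewrite [RHS]mxE; move: t.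
apply: (@bezout_ideal (fun x => x = 0)) => //.
- by move=> x y -> ->; rewrite addr0.
- by move=> c x ->; rewrite mulr0.
- by move=> t; rewrite wL mxE.
Qed.

Lemma ev_powers u f b : (size f <= k)%N -> ev (u *m powers n) f b = phi f * u 0 b.
Proof.
move=> sf; rewrite (phi_coef sf).
rewrite -(sum_rev_ord k (fun I => phi (f`_I)%:P * phi 'X ^+ I)) mulr_suml.
apply: eq_bigr => j _; rewrite mxE (bigD1 b) //= big1.
  by rewrite !mxE mxtens_indexK eqxx addr0 mulr1n; ring.
by move=> c cb; rewrite !mxE mxtens_indexK (negPf cb) mulr0n mulr0.
Qed.

Lemma powers_ansatz : powers n *m map_mx cst ansatz_mx = (phi v)%:M.
Proof.
apply/row_matrixP => i; rewrite row_mul rowE.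
apply/rowP => b; rewrite mul_ansatz_mx ev_powers // !mxE.
by rewrite eqxx /= mulr_natr eq_sym.
Qed.

(** Putting x = z in the identity of DL shows that the functional f |-> f(z) u is sent to v(y) P(z)
    u, whose coefficients are multiples of entries of P(z) u. *)
Lemma powers_DLmx (S : A -> Prop) u : S 0 -> (forall c x, S x -> S (c * x)) ->
  (forall a, S ((u *m (map_mx phi P)^T) 0 a)) ->
  forall t, S ((u *m powers n *m (map_mx phi (DLmx k P v))^T) 0 t).
Proof.
move=> S0 SM Su t; case: (mxtens_indexP t) => i a; rewrite mul_DLmx.
set I := (k.-1 - i)%N.
have -> : \sum_b phi ((P a b)`_I)%:P * ev (u *m powers n) v b +
  bez_ev (u *m powers n) a I - phi 'X * bez_ev (u *m powers n) a I.+1 =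
  phi (v`_I)%:P * (u *m (map_mx phi P)^T) 0 a; last exact: SM.
rewrite mxE !mulr_sumr -big_split -sumrB; apply: eq_bigr => b _ /=.
rewrite !ev_powers ?size_bez // [in phi (bez _ _ I)]bezS !mxE.
by move: (bez _ _ _) => B; rewrite !(rmorphD, rmorphN, rmorphM) /=; ring.
Qed.

End Action.

End Ansatz.

(** * Nullities, eigenvalues and partial multiplicities of the pencil *)

Section Nullity.
Variables (F : fieldType) (k m n : nat) (P : 'M[{poly F}]_(m, n)) (v : {poly F}).
Hypotheses (gP : has_grade k P) (sv : (size v <= k)%N).

Section Field.
Variables (K : fieldType) (phi : {rmorphism {poly F} -> K}).
Let Pi := map_mx (cst phi) (ansatz_mx k n v).
Let C := map_mx (cst phi) (core_mx k P v).

Lemma rank_ker_core : \rank (kermx C) = core_nullity k P v.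
Proof. by rewrite mxrank_ker mxrank_map. Qed.

Lemma ker_coreP r (X : 'M[K]_(r, k * n)) :
  X *m Pi = 0 -> X *m (map_mx phi (DLmx k P v))^T = 0 -> (X <= kermx C)%MS.
Proof.
move=> XP XL; apply/row_subP => i; apply/sub_kermxP/(core_mxP _ gP sv).
by rewrite -!row_mul XP XL !row0.
Qed.

Lemma ker_core_DLmx r (X : 'M[K]_(r, k * n)) : (X <= kermx C)%MS ->
  X *m Pi = 0 /\ X *m (map_mx phi (DLmx k P v))^T = 0.
Proof.
move/row_subP => XC; split; apply/row_matrixP => i; rewrite row_mul row0;
  by have /sub_kermxP/(core_mxP _ gP sv)[] := XC i.
Qed.

Lemma mul_ansatz_kerP r (X : 'M[K]_(r, k * n)) :
  X *m (map_mx phi (DLmx k P v))^T = 0 -> X *m Pi *m (map_mx phi P)^T = 0.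
Proof. by move=> XL; rewrite -mulmxA DLmx_left // mulmxA XL mul0mx. Qed.

Lemma rank_ker_split r (X : 'M[K]_(r, k * n)) :
  X *m (map_mx phi (DLmx k P v))^T = 0 ->
  (\rank X <= \rank (X *m Pi) + core_nullity k P v)%N.
Proof.
move=> XL; rewrite -(mxrank_mul_ker X Pi) leq_add2l -rank_ker_core.
apply/mxrankS/ker_coreP; first exact/sub_kermxP/capmxSr.
by have /submxP[Y ->] := capmxSl X (kermx Pi); rewrite -mulmxA XL mulmx0.
Qed.

(** Valid also where [phi v = 0]: it rests only on the kernel N of w |-> w(v), whereas equality uses
    surjectivity. *)
Lemma nullity_DLmx_le :
  (k * n - \rank (map_mx phi (DLmx k P v)) <=
   n - \rank (map_mx phi P) + core_nullity k P v)%N.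
Proof.
set X := kermx (map_mx phi (DLmx k P v))^T.
have XL : X *m (map_mx phi (DLmx k P v))^T = 0 by apply: mulmx_ker.
have -> : (k * n - \rank (map_mx phi (DLmx k P v)))%N = \rank X.
  by rewrite mxrank_ker mxrank_tr.
apply: leq_trans (rank_ker_split XL) _; rewrite leq_add2r.
rewrite -[X in (n - X)%N]mxrank_tr -mxrank_ker.
by apply/mxrankS/sub_kermxP/mul_ansatz_kerP.
Qed.

(** On lifted vectors w |-> w(v) is multiplication by [phi v], and on N it is 0; hence the sum is
    direct. *)
Lemma rank_powers_core r (W : 'M[K]_(r, n)) : phi v != 0 ->
  \rank (W *m powers k phi n + kermx C)%MS = (\rank W + core_nullity k P v)%N.
Proof.
move=> v0; rewrite mxrank_disjoint_sum; last first.
  apply/eqP; rewrite -submx0; apply/row_subP => i.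
  set w := row i _; have wS : (w <= W *m powers k phi n :&: kermx C)%MS by apply: row_sub.
  have /submxP[y wy] := submx_trans wS (capmxSl _ _).
  have [wP _] := ker_core_DLmx (submx_trans wS (capmxSr _ _)).
  move: wP; rewrite wy -!mulmxA powers_ansatz // mul_mx_scalar -scalemxAr => /eqP.
  by rewrite scaler_eq0 (negPf v0) /= mulmxA => /eqP ->; rewrite mul0mx sub0mx.
rewrite rank_ker_core mxrankMfree //.
rewrite -row_leq_rank -[X in (X <= _)%N](mxrank1 K n) -(mxrank_scale_nz _ v0) scalemx1.
by rewrite -(powers_ansatz (k := k)) // mxrankM_maxl.
Qed.

Lemma nullity_DLmx : phi v != 0 ->
  (k * n - \rank (map_mx phi (DLmx k P v)) =
   n - \rank (map_mx phi P) + core_nullity k P v)%N.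
Proof.
move=> v0; apply/eqP; rewrite eqn_leq nullity_DLmx_le.
rewrite -[X in (n - X)%N]mxrank_tr -mxrank_ker -rank_powers_core //.
rewrite -[X in (_ - X)%N]mxrank_tr -mxrank_ker; apply: mxrankS.
rewrite addsmx_sub; apply/andP; split; apply/sub_kermxP; last first.
  exact: (proj2 (ker_core_DLmx (submx_refl _))).
apply/row_matrixP => i; rewrite row_mul (row_mul i (kermx _)) row0.
apply/rowP => t; rewrite [RHS]mxE.
apply: (powers_DLmx gP sv (S := fun x => x = 0)) => // [c x ->|a].
  by rewrite mulr0.
by have /row_subP/(_ i)/sub_kermxP -> := submx_refl (kermx (map_mx phi P)^T); rewrite mxE.
Qed.

End Field.

(** The nullity of L(a) is at most that of P(a) plus dim N; as P(a) has no excess nullity, this is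
    the nullity of L over F(z). *)
Lemma DLmx_not_eigenvalue a : v != 0 -> ~ fin_eigenvalue P a ->
  ~ fin_eigenvalue (DLmx k P v) a.
Proof.
rewrite /fin_eigenvalue => v0 /negP; rewrite -leqNgt => rP; apply/negP; rewrite -leqNgt.
have H1 := nullity_DLmx_le (horner_eval a).
have H2 : (k * n - \rank (ratmx (DLmx k P v)) =
   n - \rank (ratmx P) + core_nullity k P v)%N.
  by apply: nullity_DLmx; rewrite tofrac_eq0.
have := rank_leq_col (ratmx (DLmx k P v)); have := rank_leq_col (ratmx P).
have := rank_leq_col (map_mx (horner_eval a) (DLmx k P v)).
move: H1 H2 rP; rewrite -!/(map_mx (horner_eval a) _).
move: (\rank _) (\rank _) (\rank _) (\rank _) (core_nullity _ _ _); lia.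
Qed.

Lemma DLmx_eigenvalue a : v != 0 -> ~~ root v a ->
  fin_eigenvalue P a <-> fin_eigenvalue (DLmx k P v) a.
Proof.
rewrite /fin_eigenvalue => v0 va.
have H1 : (k * n - \rank (map_mx (horner_eval a) (DLmx k P v)) =
   n - \rank (map_mx (horner_eval a) P) + core_nullity k P v)%N.
  exact: nullity_DLmx.
have H2 : (k * n - \rank (ratmx (DLmx k P v)) =
   n - \rank (ratmx P) + core_nullity k P v)%N.
  by apply: nullity_DLmx; rewrite tofrac_eq0.
have := rank_leq_col (ratmx (DLmx k P v)); have := rank_leq_col (ratmx P).
have := rank_leq_col (map_mx (horner_eval a) (DLmx k P v)).
have := rank_leq_col (map_mx (horner_eval a) P).
move: H1 H2; rewrite -!/(map_mx (horner_eval a) _).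
move: (\rank _) (\rank _) (\rank _) (\rank _) (core_nullity _ _ _); lia.
Qed.

Lemma map_powers a q : map_mx (horner_eval a) (powers k (idfun : {rmorphism {poly F} -> {poly F}}) q) =
  powers k (horner_eval a) q.
Proof.
apply/matrixP => b t; rewrite !mxE rmorphMn rmorphXn /=.
by rewrite /horner_eval hornerX.
Qed.

Lemma local_dim_DLmx a h e : ~~ root v a -> (0 < h)%N ->
  local_dim P a h e -> local_dim (DLmx k P v) a h (e + core_nullity k P v).
Proof.
move=> va h0 [W rW WP]; pose ha := horner_eval a.
have va' : ha v != 0 by [].
pose id0 : {rmorphism {poly F} -> {poly F}} := idfun.
have idM q r (A : 'M[{poly F}]_(q, r)) : map_mx id0 A = A by apply: map_mx_id.
have cstE q r (A : 'M[F]_(q, r)) : map_mx (cst ha) A = A.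
  by apply/matrixP => i j; rewrite !mxE /= /ha /horner_eval hornerC.
have haC q r (A : 'M[F]_(q, r)) : map_mx ha (map_mx (cst id0) A) = A.
  by apply/matrixP => i j; rewrite !mxE /= /ha /horner_eval hornerC.
exists (W *m powers k ha n + kermx (map_mx (cst ha) (core_mx k P v)))%MS.
  by rewrite rank_powers_core ?rW.
set f := ('X - a%:P) ^+ h.
have fa q : f %| q -> ha q = 0.
  move=> fq; apply/eqP; rewrite -[_ == _]/(root q a) root_factor_theorem.
  by apply: dvdp_trans fq; rewrite /f -(prednK h0) exprS dvdp_mulr.
move=> x; split=> [/sub_addsmxP[[y z] /= ->]|[X -> fX]].
  have [Y YE fY] := proj1 (WP (y *m W)) (submxMl _ _).
  set z' := z *m _; have z'C : z' *m map_mx (cst ha) (core_mx k P v) = 0.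
    by rewrite -mulmxA mulmx_ker mulmx0.
  exists (Y *m powers k id0 n + map_mx (cst id0) z').
    by rewrite map_mxD map_mxM -YE map_powers haC mulmxA.
  move=> i; rewrite mulmxDl mxE; apply: dvdp_add; last first.
    have [_ H] : map_mx (cst id0) z' *m map_mx (cst id0) (ansatz_mx k n v) = 0 /\
        map_mx (cst id0) z' *m (map_mx id0 (DLmx k P v))^T = 0.
      by apply/(core_mxP _ gP sv); rewrite -map_mxM /= -[core_mx _ _ _]cstE z'C map_mx0.
    by move: H; rewrite idM => ->; rewrite mxE dvdp0.
  rewrite -[DLmx k P v]idM.
  apply: (powers_DLmx gP sv (phi := id0) (S := fun q => f %| q)).
  - exact: dvdp0.
  - by move=> c q fq; rewrite dvdp_mull.
  - by rewrite idM.
pose u := X *m map_mx (cst id0) (ansatz_mx k n v).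
have fu i : f %| (u *m P^T) 0 i.
  rewrite -[P]idM -mulmxA DLmx_left // mulmxA idM; exact: dvdp_mulmx.
(* Multiplying by [v] avoids inverting it in F[z]: [X'] satisfies w(v) = 0 exactly and is still a
   kernel vector modulo [f], so its value at [a] lies in N. Division by v(a) then recovers the value
   of [X]. *)
pose X' := v *: X - u *m powers k id0 n.
have X'v : X' *m map_mx (cst id0) (ansatz_mx k n v) = 0.
  rewrite mulmxBl -mulmxA powers_ansatz // mul_mx_scalar -scalemxAl.
  exact: subrr.
have fX' i : f %| (X' *m (map_mx id0 (DLmx k P v))^T) 0 i.
  rewrite mulmxBl mxE; apply: dvdp_add.
    by rewrite idM -scalemxAl mxE dvdp_mull.
  rewrite [X in _ %| X]mxE dvdpNr.
  apply: (powers_DLmx gP sv (phi := id0) (S := fun q => f %| q)).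
  - exact: dvdp0.
  - by move=> c q fq; rewrite dvdp_mull.
  - by rewrite idM.
have fbez i : f %| (X' *m map_mx (cst id0) (bezout_mx k P v)) 0 i.
  apply: (bezout_ideal gP sv (S := fun q => f %| q)) X'v fX' i.
  - exact: dvdp0.
  - by move=> p q; apply: dvdp_add.
  - by move=> c q fq; rewrite dvdp_mull.
have X'C : (map_mx ha X' <= kermx (map_mx (cst ha) (core_mx k P v)))%MS.
  apply/sub_kermxP; rewrite cstE mul_mx_row.
  rewrite -[ansatz_mx _ _ _]haC -map_mxM X'v map_mx0.
  have -> : map_mx ha X' *m bezout_mx k P v = 0; last by rewrite row_mx0.
  apply/rowP => i; rewrite -[bezout_mx _ _ _]haC -map_mxM [RHS]mxE [LHS]mxE.
  exact: fa.
have uW : (map_mx ha u <= W)%MS by apply/WP; exists u.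
have -> : map_mx ha X = (ha v)^-1 *: (map_mx ha u *m powers k ha n + map_mx ha X').
  clearbody u; rewrite /X' map_mxB map_mxZ map_mxM [map_mx ha (powers k id0 n)]map_powers addrC subrK scalerA mulVf //.
  by rewrite scale1r.
apply: scalemx_sub; apply: addmx_sub_adds => //; exact: submxMr.
Qed.

Lemma partial_mults_DLmx a l : v != 0 -> ~ (fin_eigenvalue P a /\ root v a) ->
  fin_partial_mults P a l <-> fin_partial_mults (DLmx k P v) a l.
Proof.
move=> v0 disj.
have [l1 P1] := partial_mults_exist P a.
have [l2 L2] := partial_mults_exist (DLmx k P v) a.
have E l3 l4 : fin_partial_mults P a l3 -> fin_partial_mults (DLmx k P v) a l4 -> l3 = l4.
  case: (boolP (root v a)) => va P3 L4.
    have nP : ~ fin_eigenvalue P a by move=> eP; apply: disj.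
    rewrite (partial_mults_nil nP P3).
    by rewrite (partial_mults_nil (DLmx_not_eigenvalue v0 nP) L4).
  apply: (partial_mults_eq (nu := core_nullity k P v)) P3 L4.
    by apply: nullity_DLmx; rewrite tofrac_eq0.
  by move=> h e h0; apply: local_dim_DLmx.
split=> H; first by rewrite (E _ _ H L2).
by rewrite -(E _ _ P1 H).
Qed.

End Nullity.

(** * Minimal indices *)

Section MinimalIndices.
Variable F : fieldType.
Local Notation K := {fraction {poly F}}.

Lemma ratmx_inj m n : injective (@ratmx F m n).
Proof.
move=> A B /matrixP E; apply/matrixP => i j; apply/eqP.
by have := E i j; rewrite !mxE => /eqP; rewrite tofrac_eq.
Qed.

Lemma trmx_ratmx m n (A : 'M[{poly F}]_(m, n)) : (ratmx A)^T = ratmx A^T.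
Proof. by rewrite /ratmx map_trmx. Qed.

Lemma ratmxM m n q (A : 'M[{poly F}]_(m, n)) (B : 'M_(n, q)) :
  ratmx (A *m B) = ratmx A *m ratmx B.
Proof. by rewrite /ratmx map_mxM. Qed.

(* For a minimal basis, [c] is the number of minimal indices at most [d]. *)
Definition kernel_rank m n (A : 'M[{poly F}]_(m, n)) d c : Prop :=
  (exists s (C : 'M[{poly F}]_(s, n)),
     [/\ C *m A^T = 0, forall i j, (size (C i j) <= d.+1)%N & \rank (ratmx C) = c]) /\
  forall s (C : 'M[{poly F}]_(s, n)), C *m A^T = 0 ->
     (forall i j, (size (C i j) <= d.+1)%N) -> (\rank (ratmx C) <= c)%N.

Lemma kernel_rank_uniq m n (A : 'M[{poly F}]_(m, n)) d c c' :
  kernel_rank A d c -> kernel_rank A d c' -> c = c'.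
Proof.
move=> [[s [C [CA sC <-]]] ub] [[s' [C' [CA' sC' <-]]] ub'].
by apply/eqP; rewrite eqn_leq ub ?ub'.
Qed.

Lemma right_nullityE m n (A : 'M[{poly F}]_(m, n)) :
  right_nullity A = (n - \rank (ratmx A))%N.
Proof. by rewrite /right_nullity mxrank_ker mxrank_tr. Qed.

Lemma poly_basis_exists m n (A : 'M[{poly F}]_(m, n)) :
  exists B : 'M[{poly F}]_(n, right_nullity A), poly_basis A B.
Proof.
suff H p r : (r + p = n)%N -> \rank (ratmx A) = r ->
    exists B : 'M[{poly F}]_(n, p), poly_basis A B.
  by apply: (H _ (\rank (ratmx A))) => //; rewrite right_nullityE subnKC ?rank_leq_col.
move=> E; case: n / E A => A rA.
have [B [B' [AB BB _]]] := kernel_factor rA.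
exists B; have fB : row_free (ratmx B)^T.
  rewrite -row_leq_rank -[X in (X <= _)%N](mxrank1 K p).
  have -> : 1%:M = (ratmx B)^T *m (ratmx B')^T.
    by rewrite -trmx_mul -ratmxM BB /ratmx map_mx1 trmx1.
  exact: mxrankM_maxl.
split=> //.
have sB : ((ratmx B)^T <= rker A)%MS.
  by apply/sub_kermxP; rewrite -trmx_mul -ratmxM AB /ratmx map_mx0 trmx0.
rewrite -(geq_leqif (mxrank_leqif_eq sB)) mxrank_ker mxrank_tr rA addKn.
by move: fB; rewrite -row_leq_rank.
Qed.

Lemma minimal_basis_exists m n (A : 'M[{poly F}]_(m, n)) :
  exists B : 'M[{poly F}]_(n, right_nullity A), minimal_basis A B.
Proof.
have [B AB] := poly_basis_exists A.
move: {2}(\sum_j _)%N (leqnn (\sum_j col_degree B j)) => d.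
elim: d B AB => [|d IH] B AB sB.
  by exists B; split=> // B' _; apply: leq_trans sB _.
case: (classic (exists2 B' : 'M[{poly F}]_(n, right_nullity A), poly_basis A B' &
   (\sum_j col_degree B' j < \sum_j col_degree B j)%N)) => [[B' AB' sB']|nB].
  by apply: IH AB' _; rewrite -ltnS (leq_trans sB').
exists B; split=> // B' AB'; rewrite leqNgt; apply/negP => sB'; apply: nB.
by exists B'.
Qed.

Lemma col_degree_le n r (B : 'M[{poly F}]_(n, r)) j d :
  (col_degree B j <= d)%N <-> forall i, (size (B i j) <= d.+1)%N.
Proof.
split=> [/bigmax_leqP H i|H].
  by have := H i isT; rewrite -subn1 leq_subLR add1n.
by apply/bigmax_leqP => i _; rewrite -subn1 leq_subLR add1n.
Qed.

(* Otherwise exchanging the [j]-th basis vector for [c] lowers the degree sum. *)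
Lemma minimal_basis_exchange m n (A : 'M[{poly F}]_(m, n))
    (B : 'M[{poly F}]_(n, right_nullity A)) d (c : 'rV[{poly F}]_n)
    (x : 'rV[K]_(right_nullity A)) j :
  minimal_basis A B -> (forall i, (size (c ord0 i) <= d.+1)%N) ->
  ratmx c = x *m (ratmx B)^T -> (d < col_degree B j)%N -> x 0 j = 0.
Proof.
move=> [[fB eB] minB] sc cx dj; apply/eqP/negPn/negP => xj.
pose B' : 'M[{poly F}]_(n, right_nullity A) :=
  \matrix_(i, j') if j' == j then c 0 i else B i j'.
have rB' : row j (ratmx B')^T = ratmx c.
  by apply/rowP => i; rewrite !mxE eqxx.
have rB j' : j' != j -> row j' (ratmx B')^T = row j' (ratmx B)^T.
  by move=> jj; apply/rowP => i; rewrite !mxE (negPf jj).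
have B'B : ((ratmx B')^T <= (ratmx B)^T)%MS.
  apply/row_subP => j'; have [->|jj] := eqVneq j' j.
    by rewrite rB' cx submxMl.
  by rewrite rB // row_sub.
have BB' : ((ratmx B)^T <= (ratmx B')^T)%MS.
  apply/row_subP => j'; have [->|jj] := eqVneq j' j; last by rewrite -rB // row_sub.
  have -> : row j (ratmx B)^T = (x 0 j)^-1 *: (ratmx c -
     \sum_(j' | j' != j) x 0 j' *: row j' (ratmx B)^T).
    rewrite cx mulmx_sum_row (bigD1 j) //= addrK scalerA mulVf // scale1r //.
  apply: scalemx_sub; rewrite addmx_sub -?rB' ?row_sub // -scaleN1r.
  apply: scalemx_sub; apply: summx_sub => t tj.
  by rewrite -rB // scalemx_sub // row_sub.
have EB : ((ratmx B')^T == (ratmx B)^T)%MS by rewrite B'B BB'.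
have eBB : ((ratmx B')^T :=: (ratmx B)^T)%MS by apply/eqmxP; rewrite B'B BB'.
suff lt : (\sum_j' col_degree B' j' < \sum_j' col_degree B j')%N.
  suff /minB : poly_basis A B' by rewrite leqNgt lt.
  split; first by rewrite /row_free eBB.
  by apply/eqmxP; apply: eqmx_trans eBB _; apply/eqmxP.
rewrite (bigD1 j) //= [X in (_ < X)%N](bigD1 j) //= -addSn leq_add //.
  apply: leq_ltn_trans dj; apply/col_degree_le => i.
  by rewrite mxE eqxx.
rewrite leq_eqVlt; apply/orP; left; apply/eqP; apply: eq_bigr => j' jj.
by apply: eq_bigr => i _; rewrite mxE (negPf jj).
Qed.

(** By the exchange lemma a kernel vector of degree at most [d] has no component along basis vectors
    of larger degree. The diagonal 0/1 matrix selects the remaining ones. *)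
Lemma kernel_rank_minimal m n (A : 'M[{poly F}]_(m, n)) gamma d :
  right_minimal_indices A gamma -> kernel_rank A d (count (leq^~ d) gamma).
Proof.
case=> B minB ->; have [[fB eB] _] := minB.
set r := right_nullity A in B minB fB eB *.
rewrite (seq.permP (permEl (perm_sort _ _))); set g := map _ _.
have sg : size g = r by rewrite size_map size_enum_ord.
have gE (j : 'I_r) : nth 0%N g j = col_degree B j.
  by rewrite (nth_map j) ?size_enum_ord // nth_ord_enum.
have rE (R : fieldType) : \rank (\matrix_(i < r, j < r)
    ((nth 0%N g i <= d)%N%:R *+ (i == j :> nat)) : 'M[R]_r) = count (leq^~ d) g.
  rewrite (rank_diag (fun i => (nth 0%N g i <= d)%N%:R)) minnn -[in RHS](count_nth_iota 0%N) sg.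
  by apply: eq_count => i; case: (_ <= _)%N; rewrite ?oner_eq0 ?eqxx.
split.
  exists r, ((\matrix_(i < r, j < r) ((nth 0%N g i <= d)%N%:R *+ (i == j :> nat))) *m B^T).
  have EE (i : 'I_r) (j : 'I_n) : ((\matrix_(i < r, j < r) ((nth 0%N g i <= d)%N%:R *+ (i == j :> nat)))
       *m B^T) i j = (nth 0%N g i <= d)%N%:R * B j i :> {poly F}.
    rewrite mxE (bigD1 i) //= big1 ?addr0 => [|t ti].
      by rewrite !mxE eqxx mulr1n.
    by rewrite !mxE eq_sym -[_ == _ :> nat]/(t == i) (negPf ti) mul0r.
  split.
  - apply: ratmx_inj; rewrite -mulmxA !ratmxM -!trmx_ratmx.
    have /andP[/sub_kermxP -> _] := eB; rewrite mulmx0 /ratmx map_mx0 //.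
  - move=> i j; rewrite EE; case: (leqP _ d) => gd; last by rewrite mulr0n mul0r size_poly0.
    rewrite mulr1n mul1r; move: gd; rewrite gE => /col_degree_le; exact.
  rewrite ratmxM -trmx_ratmx mxrankMfree // -(rE K); congr (\rank _).
  by apply/matrixP => i j; rewrite !mxE rmorphMn rmorph_nat.
move=> s C CA sC.
have [/submxP[X XC]] : ((ratmx C) <= (ratmx B)^T)%MS.
  rewrite (eqmxP eB); apply/sub_kermxP; rewrite trmx_ratmx -ratmxM CA /ratmx map_mx0 //.
have XE : X = X *m \matrix_(i < r, j < r) ((nth 0%N g i <= d)%N%:R *+ (i == j :> nat)).
  apply/matrixP => i j; rewrite mxE (bigD1 j) //= big1 ?addr0 => [|t tj].
    rewrite !mxE eqxx mulr1n gE; case: (leqP _ d) => dj /=; first by rewrite mulr1n mulr1.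
    rewrite mulr0n mulr0; have := @minimal_basis_exchange _ _ A B d (row i C) (row i X) j minB.
    rewrite mxE; apply=> //; first by move=> t; rewrite mxE.
    by rewrite -row_mul -XC; apply/rowP => t; rewrite !mxE.
  by rewrite [X in _ * X]mxE -[_ == _ :> nat]/(t == j) (negPf tj) mulr0.
by rewrite XC mxrankMfree // XE -(rE K) mxrankM_maxr.
Qed.

Lemma right_minimal_indices_exist m n (A : 'M[{poly F}]_(m, n)) :
  exists gamma, right_minimal_indices A gamma.
Proof.
have [B minB] := minimal_basis_exists A.
by exists (sort leq [seq col_degree B j | j <- enum 'I_(right_nullity A)]), B.
Qed.

Lemma right_minimal_indices_sorted m n (A : 'M[{poly F}]_(m, n)) gamma :
  right_minimal_indices A gamma -> sorted leq gamma /\ size gamma = right_nullity A.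
Proof.
case=> B _ ->; rewrite size_sort size_map size_enum_ord; split=> //.
by apply: sort_sorted; apply: leq_total.
Qed.

(** The numbers of indices at most [d] and the length determine the list; a shift of all of them by
    [nu], from [d = 0] on, amounts to [nu] further zeros. *)
Lemma right_minimal_indices_shift m n m' n' (A : 'M[{poly F}]_(m, n))
    (A' : 'M[{poly F}]_(m', n')) nu gamma gamma' :
  right_nullity A' = (nu + right_nullity A)%N ->
  (forall d c, kernel_rank A d c -> kernel_rank A' d (nu + c)) ->
  right_minimal_indices A gamma -> right_minimal_indices A' gamma' ->
  gamma' = nseq nu 0%N ++ gamma.
Proof.
move=> nA AA' Ag Ag'.
have [sg zg] := right_minimal_indices_sorted Ag.
have [sg' zg'] := right_minimal_indices_sorted Ag'.
have sz : size gamma' = size (nseq nu 0%N ++ gamma).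
  by rewrite size_cat size_nseq zg zg'.
apply: sorted_counts_eq => //.
  by elim: (nu) => //= t; case: t => [|t] /=; case: (gamma) sg => //=.
have E d : count (leq^~ d) gamma' = count (leq^~ d) (nseq nu 0%N ++ gamma).
  rewrite count_cat count_nseq leq0n mul1n.
  exact: kernel_rank_uniq (kernel_rank_minimal d Ag') (AA' _ _ (kernel_rank_minimal d Ag)).
case=> [|h]; first by rewrite !(@eq_count _ (leq 0) predT) // !count_predT.
have cE (t : seq nat) : count (leq h.+1) t = (size t - count (leq^~ h) t)%N.
  rewrite -(count_predC (leq^~ h) t) addKn; apply: eq_count => x /=.
  by rewrite -ltnNge.
by rewrite !cE sz E.
Qed.

End MinimalIndices.

(** * Lifting kernel vectors without raising degrees *)

Section Lift.
Variables (F : fieldType) (k m n : nat) (P : 'M[{poly F}]_(m, n)) (v : {poly F}).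
Hypotheses (gP : has_grade k P) (sv : (size v <= k)%N) (v0 : v != 0).
Let id0 : {rmorphism {poly F} -> {poly F}} := idfun.

(* Truncating the quotient accounts for the roots of [v] at infinity, that is,
   for [deg v < k - 1]. *)
Definition trunc_div d (f : {poly F}) : {poly F} := take_poly d (f %/ v).

Lemma trunc_divD d f g : trunc_div d (f + g) = trunc_div d f + trunc_div d g.
Proof. by rewrite /trunc_div divpD take_polyD. Qed.

Lemma trunc_divZ d c f : trunc_div d (c *: f) = c *: trunc_div d f.
Proof. by rewrite /trunc_div divpZl take_polyZ. Qed.

Lemma trunc_div_sum d I (r : seq I) (f : I -> {poly F}) :
  trunc_div d (\sum_(i <- r) f i) = \sum_(i <- r) trunc_div d (f i).
Proof.
apply: (big_morph (trunc_div d) (trunc_divD d)).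
by rewrite /trunc_div div0p take_poly0r.
Qed.

Lemma trunc_divK d (f : {poly F}) : (size f <= d)%N -> trunc_div d (v * f) = f.
Proof. by move=> sf; rewrite /trunc_div mulKp // take_poly_id. Qed.

(** For u a row of [C], P u = 0 turns the Bezoutian applied to u into -v g_J, where g_J is the sum
    of the [drop_poly J (P a b)] times u_b; the division by v is exact and g_J survives truncation.
    The kernel equations become the recurrence [gS]. *)
Lemma DLmx_lift d s (C : 'M[{poly F}]_(s, n)) :
  C *m P^T = 0 -> (forall i j, (size (C i j) <= d)%N) ->
  exists W : 'M[{poly F}]_(s, k * n),
    [/\ W *m (DLmx k P v)^T = 0, W *m map_mx polyC (ansatz_mx k n v) = C &
        forall i j, (size (W i j) <= d)%N].
Proof.
move=> CP sC.
pose W : 'M[{poly F}]_(s, k * n) := \matrix_(i, t)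
  let t' := mxtens_unindex t in trunc_div d ('X^(k.-1 - t'.1) * C i t'.2).
have evW i (f : {poly F}) b : (size f <= k)%N -> ev id0 (row i W) f b = trunc_div d (f * C i b).
  move=> sf; rewrite [X in _ = trunc_div d (X * _)](phi_coef id0 sf : f = \sum_(i < k) (f`_i)%:P * 'X^i).
  rewrite -(sum_rev_ord k (fun I => (f`_I)%:P * 'X^I)) mulr_suml trunc_div_sum.
  apply: eq_bigr => j _; rewrite /id0 /= !mxE mxtens_indexK /=.
  by rewrite !mul_polyC -scalerAl trunc_divZ.
have rowE0 i a : \sum_b P a b * C i b = 0.
  transitivity ((C *m P^T) i a); last by rewrite CP mxE.
  by rewrite mxE; apply: eq_bigr => b _; rewrite mxE mulrC.
exists W; split; last by move=> i t; rewrite mxE; apply: size_take_poly.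
  apply/row_matrixP => i; rewrite row_mul row0; apply/rowP => t; rewrite [RHS]mxE.
  case: (mxtens_indexP t) => I0 a.
  have -> : DLmx k P v = map_mx id0 (DLmx k P v) by rewrite map_mx_id.
  rewrite mul_DLmx; set I := (k.-1 - I0)%N.
  pose g J := \sum_b drop_poly J (P a b) * C i b.
  have gS J : g J = \sum_b (P a b)`_J *: C i b + 'X * g J.+1.
    rewrite /g mulr_sumr -big_split; apply: eq_bigr => b _.
    by rewrite (drop_polyS _ J) -mul_polyC /=; ring.
  (* g_0 = P u = 0, and z g_(J+1) differs from g_J by a constant combination of entries of u, so the
     size bound passes on. *)
  have sg J : (size (g J) <= d)%N.
    elim: J => [|J IH].
      by rewrite /g; under eq_bigr => b _ do rewrite drop_poly0l; rewrite rowE0 size_poly0.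
    have sX : (size ('X * g J.+1)%R <= d)%N.
      have -> : 'X * g J.+1 = g J - \sum_b (P a b)`_J *: C i b by rewrite (gS J) addrC addKr.
      rewrite (leq_trans (size_polyD _ _)) // geq_max IH size_polyN.
      apply: (big_ind (fun q : {poly F} => (size q <= d)%N)); rewrite ?size_poly0 //.
        by move=> x y sx sy; rewrite (leq_trans (size_polyD _ _)) // geq_max sx sy.
      by move=> b _; rewrite (leq_trans (size_scale_leq _ _)).
    have [->|g0] := eqVneq (g J.+1) 0; first by rewrite size_poly0.
    by move: sX; rewrite mulrC size_mulX // => /ltnW.
  have bezW J : bez_ev P v id0 (row i W) a J = - g J.
    rewrite /bez_ev; under eq_bigr => b _ do rewrite evW ?size_bez //.
    rewrite -trunc_div_sum -[RHS](@trunc_divK d) ?size_polyN //.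
    congr trunc_div.
    transitivity (drop_poly J v * (\sum_b P a b * C i b) - v * g J).
      by rewrite /g !mulr_sumr -sumrB; apply: eq_bigr => b _; rewrite /bez; ring.
    by rewrite rowE0 mulr0 add0r mulrN.
  rewrite !bezW (eq_bigr (fun b => (P a b)`_I *: C i b)); last first.
    by move=> b _; rewrite evW // trunc_divK // mul_polyC.
  by rewrite /= (gS I) -/I; ring.
apply/row_matrixP => i; rewrite row_mul; apply/rowP => b.
have := mul_ansatz_mx v id0 (row i W) b; rewrite evW // trunc_divK // => E.
rewrite [RHS]mxE -E; congr ((_ *m _) _ _); by apply/matrixP => x y; rewrite !mxE.
Qed.

(** A constant basis of N stacked on the lifts gives the lower bound, as w |-> w(v) separates the
    two. For the upper bound, w(v) has at most the degree of w because [v] has constant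
    coefficients. *)
Lemma kernel_rank_DLmx d c : kernel_rank P d c ->
  kernel_rank (DLmx k P v) d (core_nullity k P v + c).
Proof.
pose phi := @tofrac {poly F} : {rmorphism {poly F} -> {fraction {poly F}}}.
have PiE : map_mx (cst phi) (ansatz_mx k n v) = ratmx (map_mx polyC (ansatz_mx k n v)).
  by apply/matrixP => i j; rewrite !mxE.
have LE s (W : 'M_(s, k * n)) : W *m (DLmx k P v)^T = 0 ->
    ratmx W *m (map_mx phi (DLmx k P v))^T = 0.
  by move=> WL; rewrite [(map_mx _ _)^T]trmx_ratmx -ratmxM WL /ratmx map_mx0.
have ub s (W : 'M_(s, k * n)) : W *m (DLmx k P v)^T = 0 ->
    (\rank (ratmx W) <= core_nullity k P v +
       \rank (ratmx (W *m map_mx polyC (ansatz_mx k n v))))%N.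
  move=> WL; rewrite addnC ratmxM -PiE; apply: rank_ker_split => //; exact: LE.
case=> [[s [C [CP sC rC]]] maxC]; split; last first.
  move=> t W WL sW; apply: leq_trans (ub _ _ WL) _; rewrite leq_add2l; apply: maxC.
    have := mul_ansatz_kerP gP sv (LE _ _ WL); rewrite PiE [(map_mx _ _)^T]trmx_ratmx -!ratmxM.
    by move=> H; apply: ratmx_inj; rewrite H /ratmx map_mx0.
  move=> i j; rewrite mxE; apply: (big_ind (fun q : {poly F} => (size q <= d.+1)%N)).
  - by rewrite size_poly0.
  - by move=> x y sx sy; rewrite (leq_trans (size_polyD _ _)) // geq_max sx sy.
  - by move=> u _; rewrite mxE mulrC mul_polyC (leq_trans (size_scale_leq _ _)).
have [W [WL WC sW]] := DLmx_lift CP sC.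
pose N := row_base (kermx (core_mx k P v)).
have [Nv NL] : map_mx polyC N *m map_mx polyC (ansatz_mx k n v) = 0 /\
    map_mx polyC N *m (DLmx k P v)^T = 0.
  have H : (map_mx polyC N *m map_mx polyC (core_mx k P v)) = 0.
    rewrite -map_mxM; have /sub_kermxP -> : (N <= kermx (core_mx k P v))%MS by rewrite eq_row_base.
    by rewrite map_mx0.
  split; apply/row_matrixP => i; rewrite row_mul row0.
    have /(core_mxP id0 gP sv) [] // : row i (map_mx polyC N) *m map_mx (cst id0) (core_mx k P v) = 0.
    have -> : map_mx (cst id0) (core_mx k P v) = map_mx polyC (core_mx k P v) by apply/matrixP => x y; rewrite !mxE.
    by rewrite -row_mul H row0.
  have /(core_mxP id0 gP sv) [_] : row i (map_mx polyC N) *m map_mx (cst id0) (core_mx k P v) = 0.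
    have -> : map_mx (cst id0) (core_mx k P v) = map_mx polyC (core_mx k P v) by apply/matrixP => x y; rewrite !mxE.
    by rewrite -row_mul H row0.
  by have -> : map_mx id0 (DLmx k P v) = DLmx k P v by rewrite map_mx_id.
exists _, (col_mx (map_mx polyC N) W); split.
- by rewrite mul_col_mx NL WL col_mx0.
- move=> i j; case: (fintype.split_ordP i) => t ->; rewrite ?col_mxEu ?col_mxEd //.
  by rewrite mxE (leq_trans (size_polyC_leq1 _)).
have XL : col_mx (map_mx polyC N) W *m (DLmx k P v)^T = 0.
  by rewrite mul_col_mx NL WL col_mx0.
have XC : col_mx (map_mx polyC N) W *m map_mx polyC (ansatz_mx k n v) = col_mx 0 C.
  by rewrite mul_col_mx Nv WC.
have r0C : \rank (ratmx (col_mx (0 : 'M_(\rank (kermx (core_mx k P v)), n)) C)) = c.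
  by rewrite -rC /ratmx map_col_mx map_mx0 rank_col_0mx.
apply/eqP; rewrite eqn_leq -{1}r0C -XC ub //=.
set X := col_mx _ _ in XL XC *.
rewrite -(mxrank_mul_ker (ratmx X) (ratmx (map_mx polyC (ansatz_mx k n v)))) -ratmxM XC r0C.
rewrite [X in (X <= _)%N]addnC leq_add2l.
have -> : core_nullity k P v = \rank (ratmx (map_mx polyC N)).
  transitivity (\rank (map_mx (cst phi) N)).
    by rewrite mxrank_map eq_row_base mxrank_ker.
  by congr (\rank _); apply/matrixP => i j; rewrite !mxE.
apply: mxrankS; rewrite sub_capmx; apply/andP; split.
  by rewrite /X /ratmx map_col_mx -addsmxE addsmxSl.
by apply/sub_kermxP; rewrite -ratmxM Nv /ratmx map_mx0.
Qed.

End Lift.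

(** * The dimension of the constant kernel *)

Section LinearBounds.
Variables (F : fieldType) (N r q1 q2 p : nat) (Q : 'M[F]_(N, r)).

Lemma lin1_mxP q (g : 'rV[F]_N -> 'rV[F]_q) : linear g ->
  exists B : 'M_(N, q), forall w, g w = w *m B.
Proof.
move=> lg.
pose gl : {linear 'rV[F]_N -> 'rV[F]_q} :=
  HB.pack g (GRing.isLinear.Build F 'rV[F]_N 'rV[F]_q *:%R g lg).
by exists (lin1_mx gl) => w; rewrite mul_rV_lin1.
Qed.

Lemma nullity_le_inj (g1 : 'rV[F]_N -> 'M[F]_(p, q1)) (g2 : 'rV[F]_N -> 'M[F]_(p, q2)) :
  linear g1 -> linear g2 ->
  (forall w, w *m Q = 0 -> g1 w = 0 -> g2 w = 0 -> w = 0) ->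
  (N - \rank Q <= p * q1 + p * q2)%N.
Proof.
move=> l1 l2 inj.
have [B1 E1] : exists B : 'M_(N, p * q1), forall w, mxvec (g1 w) = w *m B.
  by apply: (@lin1_mxP _ (fun w => mxvec (g1 w))) => a u w; rewrite l1 linearP.
have [B2 E2] : exists B : 'M_(N, p * q2), forall w, mxvec (g2 w) = w *m B.
  by apply: (@lin1_mxP _ (fun w => mxvec (g2 w))) => a u w; rewrite l2 linearP.
pose B := row_mx B1 B2.
suff rf : row_free (row_mx Q B).
  have := rf; rewrite -row_leq_rank => H; rewrite leq_subLR (leq_trans H) //.
  rewrite -mxrank_tr tr_row_mx -addsmxE (leq_trans (mxrank_adds_leqif _ _)) //.
  by rewrite !mxrank_tr leq_add2l rank_leq_col.
rewrite -kermx_eq0; apply/eqP/row_matrixP => i; rewrite row0.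
set w := row i _; have : w *m row_mx Q B = 0.
  by rewrite /w -row_mul mulmx_ker row0.
rewrite mul_mx_row mul_mx_row -E1 -E2 -[X in _ = X]row_mx0 => /eq_row_mx[wQ].
rewrite -[X in _ = X]row_mx0 => /eq_row_mx[w1 w2].
by apply: inj => //; apply/eqP; rewrite -mxvec_eq0 ?w1 ?w2.
Qed.

End LinearBounds.

Lemma nullity_ge_inj (F : fieldType) (N r q1 q2 p : nat) (Q : 'M[F]_(N, r))
    (h1 : 'M[F]_(p, q1) -> 'rV[F]_N) (h2 : 'M[F]_(p, q2) -> 'rV[F]_N) :
  linear h1 -> linear h2 ->
  (forall M1 M2, (h1 M1 + h2 M2) *m Q = 0) ->
  (forall M1 M2, h1 M1 + h2 M2 = 0 -> M1 = 0 /\ M2 = 0) ->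
  (p * q1 + p * q2 <= N - \rank Q)%N.
Proof.
move=> l1 l2 hQ inj.
have [B1 E1] : exists B : 'M_(p * q1, N), forall w, h1 (vec_mx w) = w *m B.
  by apply: (@lin1_mxP _ _ _ (fun w => h1 (vec_mx w))) => a u w; rewrite linearP l1.
have [B2 E2] : exists B : 'M_(p * q2, N), forall w, h2 (vec_mx w) = w *m B.
  by apply: (@lin1_mxP _ _ _ (fun w => h2 (vec_mx w))) => a u w; rewrite linearP l2.
pose B := col_mx B1 B2.
have E w : w *m B = h1 (vec_mx (lsubmx w)) + h2 (vec_mx (rsubmx w)).
  by rewrite -{1}[w]hsubmxK mul_row_col E1 E2.
have BQ : B *m Q = 0.
  by apply/row_matrixP => i; rewrite row_mul rowE E hQ row0.
have rf : row_free B.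
  rewrite -kermx_eq0; apply/eqP/row_matrixP => i; rewrite row0.
  set w := row i _; have : w *m B = 0 by rewrite /w -row_mul mulmx_ker row0.
  rewrite E => /inj[/eqP w1 /eqP w2]; rewrite -[w]hsubmxK.
  move: w1 w2; rewrite !vec_mx_eq0 => /eqP -> /eqP ->; exact: row_mx0.
by have := mulmx0_rank_max BQ; rewrite (eqP rf); lia.
Qed.

Section Core.
Variables (F : fieldType) (k m n : nat) (P : 'M[{poly F}]_(m, n)) (v : {poly F}).
Hypotheses (gP : has_grade k P) (sv : (size v <= k)%N) (v0 : v != 0).
Implicit Types (f g W : {poly F}).

(** [W] stores a functional w through its values w(x^J) as coefficients, so this is w(f) for f of
    degree below [k]. *)
Definition pair f W : F := \sum_(J < k) f`_J * W`_J.

Lemma pairDl f g W : pair (f + g) W = pair f W + pair g W.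
Proof. by rewrite -big_split; apply: eq_bigr => J _; rewrite coefD mulrDl. Qed.

Lemma pairZl c f W : pair (c *: f) W = c * pair f W.
Proof. by rewrite mulr_sumr; apply: eq_bigr => J _; rewrite coefZ mulrA. Qed.

Lemma pair0l W : pair 0 W = 0.
Proof. by rewrite /pair big1 // => J _; rewrite coef0 mul0r. Qed.

Lemma pair_suml I (r : seq I) (f : I -> {poly F}) W :
  pair (\sum_(i <- r) f i) W = \sum_(i <- r) pair (f i) W.
Proof. exact: (big_morph (pair^~ W) (fun f g => pairDl f g W) (pair0l W)). Qed.

Lemma pairPr c f W W' : pair f (c *: W + W') = c * pair f W + pair f W'.
Proof.
rewrite mulr_sumr -big_split; apply: eq_bigr => J _.
by rewrite coefD coefZ /=; ring.
Qed.

Lemma bez_sum p I : bez p v I =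
  \sum_(s < I) (p`_s *: drop_poly (I - s) v - v`_s *: drop_poly (I - s) p).
Proof.
elim: I => [|I IH]; first by rewrite big_ord0 bez0.
have X0 : 'X != 0 :> {poly F} by rewrite polyX_eq0.
apply: (mulfI X0).
have -> : 'X * bez p v I.+1 = bez p v I - p * (v`_I)%:P + v * (p`_I)%:P.
  by rewrite [bez p v I]bezS; ring.
have E (f g : {poly F}) : 'X * \sum_(s < I.+1) f`_s *: drop_poly (I.+1 - s) g =
    \sum_(s < I) f`_s *: drop_poly (I - s) g + f`_I *: g
    - (\sum_(s < I.+1) f`_s * g`_(I - s))%:P.
  rewrite mulr_sumr rmorph_sum -[X in _ = X - _]
    (_ : \sum_(s < I.+1) f`_s *: drop_poly (I - s) g = _); last first.
    by rewrite big_ord_recr /= subnn drop_poly0l.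
  rewrite -sumrB; apply: eq_bigr => s _.
  have -> : (I.+1 - s)%N = (I - s).+1 by rewrite subSn // -ltnS.
  rewrite [X in _ = _ *: X - _]drop_polyS.
  move: (drop_poly _ _) (g`_ _) (f`_ _) => D d c.
  by rewrite -scalerAr scalerDr rmorphM /= mul_polyC [RHS]addrAC subrr add0r.
rewrite IH !sumrB mulrBr !E.
have -> : \sum_(s < I.+1) v`_s * p`_(I - s) = \sum_(s < I.+1) p`_s * v`_(I - s).
  rewrite (reindex_inj rev_ord_inj); apply: eq_bigr => s _ /=.
  rewrite subSS subKn; last by rewrite -ltnS.
  by rewrite mulrC.
by rewrite -(mul_polyC p`_I) -(mul_polyC v`_I); ring.
Qed.

(** The functional applied in x to (f(x) - f(y)) / (x - y), or equivalently the polynomial part of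
    f(y) times the sum of the w(x^J) y^(-J-1). *)
Definition dpoly f W : {poly F} := \poly_(J < k) pair (drop_poly J.+1 f) W.

Lemma coef_dpoly f W J : (size f <= k.+1)%N ->
  (dpoly f W)`_J = pair (drop_poly J.+1 f) W.
Proof.
move=> sf; rewrite coef_poly; case: ltnP => // kJ.
by rewrite drop_poly_eq0 ?pair0l // (leq_trans sf).
Qed.

(** Turns the Bezoutian conditions into an identity P g = v h in F[y], where g has the entries
    [dpoly v (W b)]: a kernel vector of P modulo v. *)
Lemma coef_dpoly_comb a (W : 'I_n -> {poly F}) I :
  (\sum_b P a b * dpoly v (W b) - v * \sum_b dpoly (P a b) (W b))`_I =
  \sum_b pair (bez (P a b) v I.+1) (W b).
Proof.
rewrite mulr_sumr -sumrB coef_sum; apply: eq_bigr => b _.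
rewrite coefB !coefM bez_sum pair_suml -sumrB; apply: eq_bigr => s _.
rewrite !coef_dpoly ?gP ?(leqW sv) //.
have -> : (I.+1 - s)%N = (I - s).+1 by rewrite subSn // -ltnS.
by rewrite pairDl -scaleNr !pairZl mulNr.
Qed.

Definition wpoly (w : 'rV[F]_(k * n)) b : {poly F} :=
  \sum_(j < k) w 0 (mxtens_index (j, b)) *: 'X^(k.-1 - j).

Lemma coef_wpoly w b (j : 'I_k) : (wpoly w b)`_(k.-1 - j) = w 0 (mxtens_index (j, b)).
Proof.
rewrite coef_sum (bigD1 j) //= big1 ?addr0 => [|i ij].
  by rewrite coefZ coefXn eqxx mulr1.
rewrite coefZ coefXn; case: eqP => [E|]; rewrite ?mulr0 //.
by case/eqP: ij; apply: val_inj => /=; have := ltn_ord i; have := ltn_ord j; lia.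
Qed.

Lemma size_wpoly w b : (size (wpoly w b) <= k)%N.
Proof.
apply/leq_sizeP => J kJ; rewrite coef_sum big1 // => j _.
rewrite coefZ coefXn; case: eqP => [E|]; rewrite ?mulr0 //.
by have := ltn_ord j; lia.
Qed.

Lemma wpolyP c w w' b : wpoly (c *: w + w') b = c *: wpoly w b + wpoly w' b.
Proof.
rewrite scaler_sumr -big_split; apply: eq_bigr => j _.
by rewrite !mxE scalerDl scalerA.
Qed.

Lemma core_mx_wpolyP w : w *m core_mx k P v = 0 <->
  (forall b, pair v (wpoly w b) = 0) /\
  (forall a I, \sum_b pair (bez (P a b) v I.+1) (wpoly w b) = 0).
Proof.
pose h0 := horner_eval (0 : F).
have cstE q r (A : 'M[F]_(q, r)) : map_mx (cst h0) A = A.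
  by apply/matrixP => i j; rewrite !mxE /= /h0 /horner_eval hornerC.
have evE f b : ev h0 w f b = pair f (wpoly w b).
  rewrite /pair -(sum_rev_ord k (fun J => f`_J * (wpoly w b)`_J)); apply: eq_bigr => j _.
  by rewrite coef_wpoly /= /h0 /horner_eval hornerC.
have vE b : (w *m ansatz_mx k n v) 0 b = pair v (wpoly w b).
  by rewrite -evE -mul_ansatz_mx cstE.
have bE i a : (w *m bezout_mx k P v) 0 (mxtens_index (i, a)) =
    \sum_b pair (bez (P a b) v (k.-1 - i).+1) (wpoly w b).
  by rewrite -[bezout_mx _ _ _]cstE mul_bezout_mx; apply: eq_bigr => b _; rewrite evE.
rewrite mul_mx_row; split=> [|[wv wb]].
  rewrite -[X in _ = X]row_mx0 => /eq_row_mx[wv wb]; split=> [b|a I].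
    by rewrite -vE wv mxE.
  case: (ltnP I k) => kI.
    have ik : (k.-1 - I < k)%N by lia.
    have := bE (Ordinal ik) a; rewrite wb mxE /=.
    by have -> : (k.-1 - (k.-1 - I))%N = I by lia.
  rewrite big1 // => b _; rewrite /bez !drop_poly_eq0 ?mulr0 ?subrr ?pair0l //.
    by rewrite (leq_trans (gP _ _)).
  by rewrite (leq_trans sv) // leqW.
have -> : w *m ansatz_mx k n v = 0 by apply/rowP => b; rewrite vE wv mxE.
have -> : w *m bezout_mx k P v = 0; last by rewrite row_mx0.
by apply/rowP => t; case: (mxtens_indexP t) => i a; rewrite bE wb mxE.
Qed.

Lemma wpoly_inj w : (forall b, wpoly w b = 0) -> w = 0.
Proof.
move=> w0; apply/rowP => t; case: (mxtens_indexP t) => j b.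
by rewrite -coef_wpoly w0 coef0 mxE.
Qed.

(** [e] counts the finite roots of [v], and [f] is the multiplicity of its root at infinity in grade
    k - 1. *)
Let e := (size v).-1.
Let f := (k.-1 - e)%N.

Lemma degE : size v = e.+1 /\ (e + f = k.-1)%N /\ (0 < k)%N.
Proof.
have s0 : (0 < size v)%N by rewrite size_poly_gt0.
have E : size v = e.+1 by rewrite /e prednK.
by split=> //; rewrite /f; split; lia.
Qed.

(* In degrees above [deg v] the Bezoutian conditions reduce to a congruence
   for the reversed polynomial, that is, to a condition at infinity. *)
Lemma coef_revmx_comb a (W : 'I_n -> {poly F}) c : (c < f)%N ->
  (forall b J, (J <= e)%N -> (W b)`_J = 0) ->
  (\sum_b revmx k P a b * drop_poly e.+1 (W b))`_c =
  \sum_b pair (drop_poly (f - c) (P a b)) (W b).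
Proof.
move=> cf W0; have [Ev [Ek k0]] := degE.
rewrite coef_sum; apply: eq_bigr => b _.
pose g J := (P a b)`_(J + (f - c)) * (W b)`_J.
have -> : pair (drop_poly (f - c) (P a b)) (W b) = \sum_(J < k) g J.
  by apply: eq_bigr => J _; rewrite coef_drop_poly.
have -> : k = (e.+1 + f)%N by lia.
rewrite big_split_ord /= big1 ?add0r => [|J _]; last first.
  by rewrite /g W0 ?mulr0 // -ltnS.
have -> : \sum_(i < f) g (e.+1 + i)%N = \sum_(i < c.+1 + (f - c.+1)) g (e.+1 + i)%N.
  by have -> : (c.+1 + (f - c.+1))%N = f by lia.
rewrite big_split_ord /= [X in _ + X]big1 ?addr0 => [|J _]; last first.
  by rewrite /g nth_default ?mul0r // (leq_trans (gP _ _)) //; lia.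
rewrite coefMr; apply: eq_bigr => J _.
have Jc := ltn_ord J.
rewrite mxE coef_poly coef_drop_poly ifT; last by lia.
by rewrite /g; congr (_`_ _ * _`_ _); lia.
Qed.

Lemma dvdp_coef0 (u q : {poly F}) d : size u = d.+1 ->
  (forall t, (t < d)%N -> (q %% u)`_t = 0) -> u %| q.
Proof.
move=> su H; apply/modp_eq0P/polyP => t; rewrite coef0.
case: (ltnP t d) => td; first exact: H.
rewrite nth_default //; apply: leq_trans td.
by rewrite -ltnS -su ltn_modp -size_poly_gt0 su.
Qed.

Lemma linear_coef_modp (U : lmodType F) p (M : 'M[{poly F}]_(p, n)) u d
    (G : U -> 'cV[{poly F}]_n) :
  (forall c w w', G (c *: w + w') = c%:P *: G w + G w') ->
  linear (fun w => \matrix_(i < p, t < d) ((M *m G w) i 0 %% u)`_t).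
Proof.
move=> lG c w w'; apply/matrixP => i t.
have E : (M *m G (c *: w + w')) i 0 = c *: (M *m G w) i 0 + (M *m G w') i 0.
  by rewrite lG mulmxDr -scalemxAr mxE [X in X + _]mxE mul_polyC.
rewrite mxE E modpD modpZl coefD coefZ [RHS]mxE [X in _ = X + _]mxE.
by congr (_ * _ + _); rewrite [RHS]mxE.
Qed.

Lemma size_XnP d (q : {poly F}) :
  (forall t, (t < d)%N -> q`_t = 0) -> 'X^d %| q.
Proof.
move=> H; apply: (@dvdp_coef0 _ _ d); first by rewrite size_polyXn.
by move=> t td; rewrite -Pdiv.IdomainMonic.take_poly_modp coef_take_poly td H.
Qed.

Lemma dvdp_small (u q : {poly F}) : u %| q -> (size q < size u)%N -> q = 0.
Proof.
by move=> uq su; apply/eqP; apply: contraLR uq => q0; rewrite gtNdvdp.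
Qed.

Variables (p : nat) (K : 'M[{poly F}]_(n, p)) (K' : 'M[{poly F}]_(p, n)).
Variables (Q : 'M[{poly F}]_(n, p)) (Q' : 'M[{poly F}]_(p, n)).
Hypothesis Kdvd : forall g : 'cV[{poly F}]_n, (forall i, v %| (P *m g) i 0) ->
  forall j, v %| (g - K *m (K' *m g)) j 0.
Hypothesis Qdvd : forall g : 'cV[{poly F}]_n,
  (forall i, 'X^f %| (revmx k P *m g) i 0) ->
  forall j, 'X^f %| (g - Q *m (Q' *m g)) j 0.

(** A functional of N is determined by [p] remainders modulo [v] and [p] modulo ['X^f]. If all
    vanish, the vector [G w] is 0 by its degree, then w(x^J) = 0 for J <= e, and the remaining
    values vanish by the same argument at infinity. *)
Lemma core_nullity_le : (core_nullity k P v <= p * k.-1)%N.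
Proof.
have [Ev [Ek k0]] := degE.
rewrite -Ek mulnDr.
pose G (w : 'rV[F]_(k * n)) : 'cV[{poly F}]_n := \col_b dpoly v (wpoly w b).
pose eps (w : 'rV[F]_(k * n)) : 'cV[{poly F}]_n := \col_b drop_poly e.+1 (wpoly w b).
apply: (@nullity_le_inj F _ _ e f p _
   (fun w => \matrix_(i < p, t < e) ((K' *m G w) i 0 %% v)`_t)
   (fun w => \matrix_(i < p, t < f) ((Q' *m eps w) i 0 %% 'X^f)`_t)).
- apply: linear_coef_modp => c w w'; apply/colP => b; rewrite !mxE mul_polyC wpolyP.
  apply/polyP => J; rewrite coefD coefZ !coef_dpoly ?(leqW sv) //.
  exact: pairPr.
- apply: linear_coef_modp => c w w'; apply/colP => b; rewrite !mxE mul_polyC wpolyP.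
  by rewrite drop_polyD drop_polyZ.
have dvd_of_small (M : 'M[{poly F}]_(n, p)) (M' : 'M_(p, n)) (g : 'cV_n) (u : {poly F}) d :
    size u = d.+1 -> (forall j, u %| (g - M *m (M' *m g)) j 0) ->
    \matrix_(i < p, t < d) ((M' *m g) i 0 %% u)`_t = 0 ->
    (forall j, (size (g j ord0) <= d)%N) -> g = 0.
  move=> su ug M0 sg; apply/colP => j; rewrite [RHS]mxE.
  apply: (@dvdp_small u); last by rewrite su ltnS.
  have uM i : u %| (M' *m g) i 0.
    apply: (dvdp_coef0 su) => t td; have /matrixP/(_ i (Ordinal td)) := M0.
    by rewrite [LHS]mxE [RHS]mxE.
  have -> : g j 0 = (g - M *m (M' *m g)) j 0 + (M *m (M' *m g)) j 0.
    by rewrite -[in LHS](subrK (M *m (M' *m g)) g) mxE.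
  apply: dvdp_add => //; rewrite mxE; apply: (big_ind (fun q => u %| q)).
  - exact: dvdp0.
  - exact: dvdp_add.
  - by move=> t _; rewrite dvdp_mull.
move=> w /core_mx_wpolyP[wv wb] w1 w2.
have PG a : \sum_b P a b * dpoly v (wpoly w b) =
    v * \sum_b dpoly (P a b) (wpoly w b).
  apply/eqP; rewrite -subr_eq0; apply/eqP/polyP => I.
  by rewrite coef_dpoly_comb wb coef0.
have G0 : G w = 0.
  apply: (dvd_of_small K K' _ v e) => // [|j]; last first.
    rewrite mxE; apply/leq_sizeP => J eJ; rewrite coef_dpoly ?(leqW sv) //.
    by rewrite drop_poly_eq0 ?pair0l // Ev.
  apply: Kdvd => a; rewrite mxE (eq_bigr (fun b => P a b * dpoly v (wpoly w b))).
    by rewrite PG dvdp_mulr.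
  by move=> b _; rewrite mxE.
have dG b : dpoly v (wpoly w b) = 0 by move/colP/(_ b): G0; rewrite !mxE.
have vW b J : pair (drop_poly J v) (wpoly w b) = 0.
  case: J => [|J]; first by rewrite drop_poly0l.
  by rewrite -coef_dpoly ?(leqW sv) // dG coef0.
(* [drop_poly (e - J) v] has degree [J] and the leading coefficient of [v], so the system for the
   w(x^J) is triangular. *)
have Wlow b J : (J <= e)%N -> (wpoly w b)`_J = 0.
  elim/ltn_ind: J => J IH Je; have Jk : (J < k)%N by lia.
  have := vW b (e - J)%N; rewrite /pair (bigD1 (Ordinal Jk)) //= big1 => [|i iJ].
    rewrite addr0 coef_drop_poly subnKC // => /eqP; rewrite mulf_eq0.
    have -> : v`_e = lead_coef v by rewrite lead_coefE.
    by rewrite lead_coef_eq0 (negPf v0) => /eqP.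
  rewrite coef_drop_poly; case: (ltngtP i J) => ij.
  - by rewrite IH ?mulr0 //; lia.
  - by rewrite nth_default ?mul0r // Ev; lia.
  - by case/eqP: iJ; apply: val_inj.
have eps0 : eps w = 0.
  apply: (dvd_of_small Q Q' _ 'X^f f) => // [||j]; first by rewrite size_polyXn.
    apply: Qdvd => a; apply: size_XnP => t tf.
    rewrite mxE (eq_bigr (fun b => revmx k P a b * drop_poly e.+1 (wpoly w b))); last first.
      by move=> b _; rewrite [eps w b 0]mxE.
    rewrite coef_revmx_comb //.
    have -> : (f - t)%N = (f - t.+1).+1 by lia.
    have H : \sum_b dpoly (P a b) (wpoly w b) = 0.
      apply: (mulfI v0); rewrite mulr0 -PG big1 // => b _; rewrite dG mulr0 //.
    transitivity ((\sum_b dpoly (P a b) (wpoly w b))`_(f - t.+1)); last by rewrite H coef0.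
    by rewrite coef_sum; apply: eq_bigr => b _; rewrite coef_dpoly ?gP.
  by rewrite mxE size_drop_poly leq_subLR (leq_trans (size_wpoly _ _)) //; lia.
apply: wpoly_inj => b; apply/polyP => J; rewrite coef0.
case: (leqP J e) => Je; first exact: Wlow.
move/colP/(_ b): eps0; rewrite !mxE => /polyP/(_ (J - e.+1)%N).
by rewrite coef0 coef_drop_poly subnK.
Qed.

Definition coef_col d (M : 'M[F]_(p, d)) : 'cV[{poly F}]_p :=
  \col_i \sum_(t < d) M i t *: 'X^t.

Lemma coef_colP d c (M N : 'M[F]_(p, d)) :
  coef_col (c *: M + N) = c%:P *: coef_col M + coef_col N.
Proof.
apply/colP => i; rewrite !mxE mul_polyC scaler_sumr -big_split.
by apply: eq_bigr => t _; rewrite !mxE scalerDl scalerA.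
Qed.

Lemma coef_col_dvd0 (A : 'M[{poly F}]_(n, p)) (A' : 'M[{poly F}]_(p, n)) (u : {poly F}) d (M : 'M[F]_(p, d)) :
  A' *m A = 1%:M -> size u = d.+1 ->
  (forall b, u %| (A *m coef_col M) b 0) -> M = 0.
Proof.
move=> AA su uA; have uM i : u %| coef_col M i 0.
  rewrite -[coef_col M]mul1mx -AA -mulmxA mxE; apply: (big_ind (fun q => u %| q)).
  - exact: dvdp0.
  - exact: dvdp_add.
  - by move=> t _; rewrite dvdp_mull.
apply/matrixP => i t; rewrite [RHS]mxE.
have cE : coef_col M i 0 = \sum_(t < d) M i t *: 'X^t by rewrite mxE.
have sM : (size (coef_col M i ord0) < size u)%N.
  rewrite su ltnS cE; apply: (big_ind (fun q : {poly F} => (size q <= d)%N)).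
  - by rewrite size_poly0.
  - by move=> x y sx sy; rewrite (leq_trans (size_polyD _ _)) // geq_max sx sy.
  - by move=> x _; rewrite (leq_trans (size_scale_leq _ _)) // size_polyXn.
have := dvdp_small (uM i) sM; rewrite cE => /polyP/(_ t).
rewrite coef0 coef_sum (bigD1 t) //= big1 ?addr0 => [|x xt].
  by rewrite coefZ coefXn eqxx mulr1.
rewrite coefZ coefXn; case: eqP => [E|]; rewrite ?mulr0 //.
by case/eqP: xt; apply: val_inj.
Qed.

(* Up to the factor [lead_coef v], the residue of [g / v] at infinity. *)
Definition residue g : F := (g %% v)`_e.-1.

Lemma residueP c g h : residue (c *: g + h) = c * residue g + residue h.
Proof. by rewrite /residue modpD modpZl coefD coefZ. Qed.

Lemma residue_dvd g : v %| g -> residue g = 0.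
Proof. by rewrite /residue => /modp_eq0 ->; rewrite coef0. Qed.

(** A nonzero remainder times a suitable power of X has its leading coefficient in degree e - 1. *)
Lemma residue_nondeg g : (forall J, (J < e)%N -> residue ('X^J * g) = 0) -> v %| g.
Proof.
have [Ev [Ek k0]] := degE.
move=> H; apply/modp_eq0P; set r := g %% v; apply/eqP/negPn/negP => r0.
have sr : (size r <= e)%N by rewrite -ltnS -Ev ltn_modp.
have s0 : (0 < size r)%N by rewrite size_poly_gt0.
have Je : (e - size r < e)%N by lia.
have := H _ Je; rewrite /residue -modp_mul -/r modp_small; last first.
  by rewrite mulrC size_mulXn // subnK // Ev ltnS.
rewrite coefXnM ifF; last by lia.
have -> : (e.-1 - (e - size r))%N = (size r).-1 by lia.
by rewrite -lead_coefE => /eqP; rewrite lead_coef_eq0 (negPf r0).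
Qed.

(** Two independent families in N: [h1] sends c to the functionals f |-> [residue (f * K c)], and
    [h2] sends c to those that vanish on x^J for J <= e and take the coefficients of Q c modulo X^f
    as further values. *)
Lemma core_nullity_ge :
  P *m K = 0 -> K' *m K = 1%:M -> revmx k P *m Q = 0 -> Q' *m Q = 1%:M ->
  (p * k.-1 <= core_nullity k P v)%N.
Proof.
move=> PK KK PQ QQ; have [Ev [Ek k0]] := degE.
rewrite -Ek mulnDr.
pose h1 (M : 'M[F]_(p, e)) : 'rV[F]_(k * n) := \row_s
  let s' := mxtens_unindex s in residue ('X^(k.-1 - s'.1) * (K *m coef_col M) s'.2 0).
pose h2 (M : 'M[F]_(p, f)) : 'rV[F]_(k * n) := \row_s
  let s' := mxtens_unindex s in
  ('X^(e.+1) * ((Q *m coef_col M) s'.2 0 %% 'X^f))`_(k.-1 - s'.1).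
have mul_coefP d (A : 'M[{poly F}]_(n, p)) c (M N : 'M[F]_(p, d)) b :
    (A *m coef_col (c *: M + N)) b 0 = c *: (A *m coef_col M) b 0 + (A *m coef_col N) b 0.
  by rewrite coef_colP mulmxDr -scalemxAr mxE [X in X + _]mxE mul_polyC.
have coefW (w : 'rV[F]_(k * n)) (W : 'I_n -> nat -> F) :
    (forall s, w 0 s = W (mxtens_unindex s).2 (k.-1 - (mxtens_unindex s).1)%N) ->
    forall b J, (J < k)%N -> (wpoly w b)`_J = W b J.
  move=> H b J Jk; have ik : (k.-1 - J < k)%N by lia.
  have := coef_wpoly w b (Ordinal ik); rewrite H mxtens_indexK /=.
  by have -> : (k.-1 - (k.-1 - J))%N = J by lia.
have c1 M b J : (J < k)%N -> (wpoly (h1 M) b)`_J = residue ('X^J * (K *m coef_col M) b 0).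
  apply: (coefW _ (fun b J => residue ('X^J * (K *m coef_col M) b 0))).
  by move=> s; rewrite mxE.
have pair1 g M b : (size g <= k)%N ->
    pair g (wpoly (h1 M) b) = residue (g * (K *m coef_col M) b 0).
  move=> sg; rewrite -{2}[g]coefK poly_def (big_ord_widen _ (fun i => g`_i *: 'X^i) sg).
  rewrite big_mkcond mulr_suml /=.
  rewrite (big_morph residue (id1 := 0) (op1 := +%R)); first last.
  - by apply: residue_dvd; rewrite dvdp0.
  - by move=> x y; have := residueP 1 x y; rewrite scale1r mul1r.
  apply: eq_bigr => J _; rewrite c1 //; case: ltnP => gJ; last first.
    by rewrite mul0r nth_default // mul0r residue_dvd ?dvdp0.
  rewrite -scalerAl -[g`_J *: _]addr0 residueP [residue 0]residue_dvd ?dvdp0 //.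
  by rewrite addr0.
have W2 M b : wpoly (h2 M) b = 'X^(e.+1) * ((Q *m coef_col M) b 0 %% 'X^f).
  apply/polyP => J; case: (ltnP J k) => Jk.
    apply: (coefW _ (fun b J => ('X^(e.+1) * ((Q *m coef_col M) b 0 %% 'X^f))`_J)) => //.
    by move=> s; rewrite mxE.
  rewrite nth_default ?(leq_trans (size_wpoly _ _)) // coefXnM ifF; last by lia.
  rewrite nth_default //; apply: (@leq_trans f); last by lia.
  by rewrite -ltnS -[f.+1](size_polyXn F) ltn_modp -size_poly_gt0 size_polyXn.
apply: (@nullity_ge_inj F _ _ e f p _ h1 h2).
- move=> c M N; apply/rowP => s; rewrite !mxE /= mul_coefP mulrDr -scalerAr; exact: residueP.
- move=> c M N; apply/rowP => s; rewrite !mxE /= mul_coefP modpD modpZl mulrDr -scalerAr.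
  by rewrite coefD coefZ.
- move=> M1 M2; apply/core_mx_wpolyP.
  have wD b : wpoly (h1 M1 + h2 M2) b = wpoly (h1 M1) b + wpoly (h2 M2) b.
    by rewrite -[h1 M1]scale1r wpolyP !scale1r.
  have pD g b : pair g (wpoly (h1 M1 + h2 M2) b) =
      pair g (wpoly (h1 M1) b) + pair g (wpoly (h2 M2) b).
    by rewrite wD -[wpoly (h1 M1) b]scale1r pairPr scale1r mul1r.
  have low b J : (J <= e)%N -> (wpoly (h2 M2) b)`_J = 0.
    by move=> Je; rewrite W2 coefXnM ltnS Je.
  have v2 b t : pair (drop_poly t v) (wpoly (h2 M2) b) = 0.
    rewrite /pair big1 // => J _; rewrite coef_drop_poly.
    case: (leqP J e) => Je; first by rewrite low ?mulr0.
    by rewrite nth_default ?mul0r // Ev; lia.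
  split=> [b|a I].
    rewrite pD pair1 // residue_dvd ?dvdp_mulr // add0r.
    by have := v2 b 0%N; rewrite drop_poly0l.
  under eq_bigr => b _ do rewrite pD pair1 ?size_bez ?gP //.
  rewrite big_split /= -[X in X + _ = _]
    (_ : residue (\sum_b bez (P a b) v I.+1 * (K *m coef_col M1) b 0) = _); last first.
    rewrite (big_morph residue (id1 := 0) (op1 := +%R)) //.
    - by move=> x y; have := residueP 1 x y; rewrite scale1r mul1r.
    - by apply: residue_dvd; rewrite dvdp0.
  rewrite residue_dvd ?add0r; last first.
    (* The first part vanishes because [P *m K = 0]; the second is a multiple of [v] and has residue
       0. *)
    have -> : \sum_b bez (P a b) v I.+1 * (K *m coef_col M1) b 0 =
       drop_poly I.+1 v * (P *m (K *m coef_col M1)) a 0 -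
       v * \sum_b drop_poly I.+1 (P a b) * (K *m coef_col M1) b 0.
      rewrite [(P *m _) a 0]mxE !mulr_sumr -sumrB; apply: eq_bigr => b _.
      by rewrite /bez; ring.
    by rewrite mulmxA PK mul0mx mxE mulr0 sub0r dvdpNr dvdp_mulr.
  (* Only divided differences of P remain, as [h2 M2] annihilates every [drop_poly t v]. Their
     coefficients below degree f are, in reverse order, those of [revmx k P] times Q c modulo X^f,
     which vanish. *)
  have H : \sum_b dpoly (P a b) (wpoly (h2 M2) b) = 0.
    apply/polyP => t; rewrite coef0 coef_sum.
    under eq_bigr => b _ do rewrite coef_dpoly ?gP //.
    case: (ltnP t f) => tf; last first.
      rewrite big1 // => b _; rewrite /pair big1 // => J _; rewrite coef_drop_poly.
      case: (leqP J e) => Je; first by rewrite low ?mulr0.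
      by rewrite nth_default ?mul0r // (leq_trans (gP _ _)) //; lia.
    have -> : t.+1 = (f - (f - t.+1))%N by lia.
    rewrite -coef_revmx_comb //; last by lia.
    have := mulmxA (revmx k P) Q (coef_col M2); rewrite PQ mul0mx => /colP/(_ a).
    rewrite [RHS]mxE mxE => H.
    have : 'X^f %| \sum_b revmx k P a b * drop_poly e.+1 (wpoly (h2 M2) b).
      have -> : \sum_b revmx k P a b * drop_poly e.+1 (wpoly (h2 M2) b) =
         \sum_b revmx k P a b * ((Q *m coef_col M2) b 0) -
         \sum_b revmx k P a b * ((Q *m coef_col M2) b 0 %/ 'X^f * 'X^f).
        rewrite -sumrB; apply: eq_bigr => b _; rewrite W2 [X in drop_poly _ X]mulrC.
        rewrite drop_polyMXn_id -mulrBr; congr (_ * _).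
        by apply/eqP; rewrite eq_sym subr_eq addrC -divp_eq.
      rewrite H sub0r dvdpNr; apply: (big_ind (fun q => 'X^f %| q)).
      + exact: dvdp0.
      + exact: dvdp_add.
      + by move=> b _; rewrite mulrA dvdp_mull.
    by case/dvdpP => q ->; rewrite coefMXn ifT //; lia.
  have := coef_dpoly_comb a (wpoly (h2 M2)) I.
  rewrite H mulr0 subr0 => <-; rewrite coef_sum big1 // => b _.
  rewrite coefM big1 // => s _.
  by rewrite coef_dpoly ?(leqW sv) // v2 mulr0.
move=> M1 M2 E.
have wE b : wpoly (h1 M1) b + wpoly (h2 M2) b = 0.
  rewrite -[wpoly (h1 M1) b]scale1r -wpolyP scale1r E.
  by rewrite /wpoly big1 // => j _; rewrite mxE scale0r.
(* The functionals of [h2] vanish on x^J for J < e, so there the residues alone must be 0. *)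
have vK b : v %| (K *m coef_col M1) b 0.
  apply: residue_nondeg => J Je; rewrite -c1; last by lia.
  have := congr1 (fun q : {poly F} => q`_J) (wE b); rewrite coefD coef0 W2 coefXnM.
  by rewrite ltnS (ltnW Je) addr0.
split; first exact: coef_col_dvd0 KK Ev vK.
apply: (coef_col_dvd0 QQ (size_polyXn _ _)) => b.
apply/modp_eq0P; have := wE b; rewrite W2.
have -> : wpoly (h1 M1) b = 0.
  apply/polyP => J; rewrite coef0; case: (ltnP J k) => Jk; last first.
    by rewrite nth_default // (leq_trans (size_wpoly _ _)).
  by rewrite c1 // residue_dvd // dvdp_mull.
rewrite add0r => /eqP; rewrite mulf_eq0 -size_poly_eq0 size_polyXn /= => /eqP //.
Qed.

End Core.

(** * The theorem *)

Section Main.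
Variable F : closedFieldType.
Implicit Types (v : {poly F}) (k m n : nat).

Definition disjoint_spectra k m n (P : 'M[{poly F}]_(m, n)) v : Prop :=
  forall lambda, ~ (eigenvalue_at k P lambda /\ root_at k.-1 v lambda).

(** Algebraic closedness enters here: without a common root, [u] is coprime to every invariant
    factor, as [kernel_factor] requires. *)
Lemma kernel_factor_coprime m n p (A : 'M[{poly F}]_(m, n)) (u : {poly F}) :
  (\rank (ratmx A) + p = n)%N -> (forall x, root u x -> ~ fin_eigenvalue A x) ->
  exists (K : 'M[{poly F}]_(n, p)) (K' : 'M[{poly F}]_(p, n)),
    [/\ A *m K = 0, K' *m K = 1%:M &
      forall g : 'cV[{poly F}]_n, (forall i, u %| (A *m g) i 0) ->
      forall j, u %| (g - K *m (K' *m g)) j 0].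
Proof.
move E: (\rank (ratmx A)) => r rpn; case: n / rpn A E => A rA uA.
have [K [K' [AK KK H]]] := kernel_factor rA.
exists K, K'; split=> // g; apply: H => s d sA ds.
apply: Pdiv.ClosedField.root_coprimep => x ux; apply/negP => dx.
exact: uA ux (fin_eigenvalue_smith sA ds dx).
Qed.

Lemma core_nullityE k m n (P : 'M[{poly F}]_(m, n)) v :
  has_grade k P -> (size v <= k)%N -> v != 0 -> disjoint_spectra k P v ->
  core_nullity k P v = (right_nullity P * k.-1)%N.
Proof.
move=> gP sv v0 disj.
have rP : (\rank (ratmx P) + right_nullity P = n)%N.
  by rewrite right_nullityE subnKC ?rank_leq_col.
have rR : (\rank (ratmx (revmx k P)) + right_nullity P = n)%N by rewrite rank_revmx.
have [|K [K' [PK KK Kdvd]]] := @kernel_factor_coprime _ _ _ _ v rP.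
  by move=> x vx ex; apply: (disj (Some x)).
have [|Q [Q' [RQ QQ Qdvd]]] :=
  @kernel_factor_coprime _ _ _ _ ('X^(k.-1 - (size v).-1)) rR.
  (* A root exists only for a positive exponent; it is 0, and [v] then has a root at infinity. *)
  move=> x; rewrite /root hornerXn expf_eq0 => /andP[f0 /eqP ->] e0.
  by apply: (disj None); split=> //=; rewrite -subn_gt0.
apply/eqP; rewrite eqn_leq (core_nullity_le gP sv v0 Kdvd Qdvd) /=.
exact (core_nullity_ge gP sv v0 PK KK RQ QQ).
Qed.

Lemma right_nullity_DLmx k m n (P : 'M[{poly F}]_(m, n)) v :
  has_grade k P -> (size v <= k)%N -> v != 0 ->
  right_nullity (DLmx k P v) = (core_nullity k P v + right_nullity P)%N.
Proof.
move=> gP sv v0; rewrite !right_nullityE addnC.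
by apply: nullity_DLmx => //; rewrite tofrac_eq0.
Qed.

Lemma right_minimal_indices_DLmx k m n (P : 'M[{poly F}]_(m, n)) v gamma :
  has_grade k P -> (size v <= k)%N -> v != 0 -> disjoint_spectra k P v ->
  right_minimal_indices P gamma <->
  right_minimal_indices (DLmx k P v) (nseq (right_nullity P * k.-1) 0%N ++ gamma).
Proof.
move=> gP sv v0 disj; rewrite -(core_nullityE gP sv v0 disj).
have shift g g' : right_minimal_indices P g -> right_minimal_indices (DLmx k P v) g' ->
    g' = nseq (core_nullity k P v) 0%N ++ g.
  apply: right_minimal_indices_shift; first exact: right_nullity_DLmx.
  by move=> d c; apply: kernel_rank_DLmx.
have [g Pg] := right_minimal_indices_exist P.
have [g' Lg'] := right_minimal_indices_exist (DLmx k P v).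
split=> [H|/(shift _ _ Pg)]; first by rewrite -(shift _ _ H Lg').
by move=> /eqP; rewrite eqseq_cat // eqxx => /eqP ->.
Qed.

Lemma fin_eigenvalue_tr m n (A : 'M[{poly F}]_(m, n)) a :
  fin_eigenvalue A^T a <-> fin_eigenvalue A a.
Proof.
by rewrite /fin_eigenvalue -trmx_ratmx -map_trmx !mxrank_tr.
Qed.

Lemma disjoint_spectra_tr k m n (P : 'M[{poly F}]_(m, n)) v :
  disjoint_spectra k P v -> disjoint_spectra k P^T v.
Proof.
move=> disj [a|] [eP rv].
  by apply: (disj (Some a)); split=> //; apply/fin_eigenvalue_tr.
apply: (disj None); split=> //; apply/fin_eigenvalue_tr.
by rewrite /revmx map_trmx.
Qed.

Lemma finite_structure_DLmx k m n (P : 'M[{poly F}]_(m, n)) v a :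
  has_grade k P -> (size v <= k)%N -> v != 0 ->
  ~ (fin_eigenvalue P a /\ root v a) ->
  (fin_eigenvalue P a <-> fin_eigenvalue (DLmx k P v) a) /\
  (forall l, fin_partial_mults P a l <-> fin_partial_mults (DLmx k P v) a l).
Proof.
move=> gP sv v0 disj; split=> [|l]; last exact: partial_mults_DLmx.
case: (boolP (root v a)) => va; last exact: DLmx_eigenvalue.
have nP : ~ fin_eigenvalue P a by move=> eP; apply: disj.
by split=> // /(DLmx_not_eigenvalue gP sv v0 nP).
Qed.

Lemma infinite_structure_DLmx k m n (P : 'M[{poly F}]_(m, n)) v :
  has_grade k P -> (size v <= k)%N -> v != 0 -> disjoint_spectra k P v ->
  (fin_eigenvalue (revmx k P) 0 <-> fin_eigenvalue (revmx 1 (DLmx k P v)) 0) /\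
  (forall l, fin_partial_mults (revmx k P) 0 l <->
             fin_partial_mults (revmx 1 (DLmx k P v)) 0 l).
Proof.
move=> gP sv v0 disj.
have k0 : (0 < k)%N by apply: leq_trans sv; rewrite size_poly_gt0.
have eqR := DLmx_rev gP sv.
have sv' : (size (revp k.-1 v) <= k)%N by rewrite -{2}(prednK k0) size_revp.
have v0' : revp k.-1 v != 0.
  apply: contraNneq v0 => /polyP H; apply/eqP/polyP => i; rewrite coef0.
  case: (ltnP i k) => ik; last by rewrite nth_default // (leq_trans sv).
  have := H (k.-1 - i)%N; rewrite coef0 coef_poly ifT; last by lia.
  by have -> : (k.-1 - (k.-1 - i))%N = i by lia.
have [||E1 E2] := @finite_structure_DLmx k m n (revmx k P) (revp k.-1 v) 0 _ sv' v0'.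
- exact: revmx_grade.
(* The value at 0 of the reversed [v] is its coefficient of degree k - 1, which vanishes exactly
   when [v] has a root at infinity. *)
- case=> eP; rewrite /root horner_coef0 coef_poly /= subn0 => /eqP vk.
  apply: (disj None); split=> //=.
  have sk : (size v).-1 != k.-1.
    by apply: contraNneq v0 => sE; rewrite -lead_coef_eq0 lead_coefE sE vk.
  by rewrite ltn_neqAle sk -!subn1 leq_sub2r.
split=> [|l].
  by apply: iff_trans E1 (iff_sym (equiv_mx_eigenvalue 0 eqR)).
by apply: iff_trans (E2 l) (iff_sym (equiv_mx_partial_mults 0 l eqR)).
Qed.

End Main.

Theorem theorem1p1 (F : closedFieldType) (charF : [pchar F] =i pred0)
  (m n k p q : nat) (k_ge2 : (2 <= k)%N)
  (P : 'M[{poly F}]_(m, n)) (gradeP : has_grade k P)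
  (nullP : right_nullity P = p) (lnullP : left_nullity P = q)
  (v : {poly F}) (v_neq0 : v != 0) (gradev : (size v <= k.-1.+1)%N)
  (disj : forall lambda : option F,
     ~ (eigenvalue_at k P lambda /\ root_at k.-1 v lambda))
  (L : 'M[{poly F}]_(k * m, k * n)) (DL_L : is_DL P v L) :
  [/\ forall gamma : p.-tuple nat,
        right_minimal_indices P gamma <->
        right_minimal_indices L (nseq (p * k.-1) 0%N ++ gamma),
      forall eta : q.-tuple nat,
        left_minimal_indices P eta <->
        left_minimal_indices L (nseq (q * k.-1) 0%N ++ eta)
    & forall lambda : option F,
        (eigenvalue_at k P lambda <-> eigenvalue_at 1 L lambda) /\
        (forall l : seq nat,
           partial_mults k P lambda l <-> partial_mults 1 L lambda l)].
Proof.
have sv : (size v <= k)%N by rewrite -(prednK (ltnW k_ge2)).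
have -> : L = DLmx k P v by apply: DL_unique DL_L (is_DL_DLmx gradeP sv).
rewrite -{}nullP -{}lnullP; split=> [gamma|eta|[a|]].
- exact: right_minimal_indices_DLmx.
- rewrite /left_minimal_indices trmx_DLmx //; apply: right_minimal_indices_DLmx => //.
    by move=> i j; rewrite mxE.
  exact: disjoint_spectra_tr.
- exact: finite_structure_DLmx (disj (Some a)).
- exact: infinite_structure_DLmx.
Qed.
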